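(* The functional $\mathrm I:\Lambda\to[0,+\infty]$ is good: for each $M>0$ the set $\{(\mu,Q)\in\Lambda:\mathrm I(\mu,Q)\le M\}$ is compact.
   Context: Setting. $E$ is a finite set with the discrete topology; $[0,+\infty]$ carries its usual compact metrizable topology. $p=(p_{x,y})_{x,y\in E}$ is an irreducible Markov transition kernel on $E$; for each $x\in E$, $\psi_x$ is a Borel probability measure on $[0,+\infty]$ with $\psi_x(\{0\})=\psi_x(\{+\infty\})=0$ (no moment assumption). $\Lambda:=\mathcal P(E\times[0,+\infty])\times C(E\times E;[0,+\infty[)$, with the product of the narrow (weak) topology and the uniform topology. Write $\mu(x,d\tau)$ for the restriction of $\mu$ to $\{x\}\times[0,+\infty]$. Conventions: $1/0=+\infty$, $1/\infty=0$, $0\cdot\infty=0$. $\xi(x):=\sup\{c\ge0:\int\psi_x(d\tau)e^{c\tau}<+\infty\}\in[0,+\infty]$. $\Lambda_0:=\{(\mu,Q)\in\Lambda:\int_{[0,+\infty]}\mu(x,d\tau)\frac1\tau=\sum_{y\in E}Q(x,y)=\sum_{y\in E}Q(y,x)\ \ \forall x\in E\}$. For $(\mu,Q)\in\Lambda_0$: $p^Q_{x,y}:=Q(x,y)/\sum_zQ(x,z)$ and $\psi^\mu_x(d\tau):=\frac{1}{\sum_zQ(x,z)}\frac1\tau\mu(x,d\tau)$; if $Q(x,\cdot)\equiv0$, set $p^Q_{x,\cdot}:=p_{x,\cdot}$ and $\psi^\mu_x:=\psi_x$. $\mathbf H(\nu\,|\,\mu)=\sup_{\varphi\in C_{\mathrm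 b}(X)}\{\nu(\varphi)-\log\mu(e^\varphi)\}$ is the relative entropy of probability measures on a separable metric space $X$. The functional $\mathrm I:\Lambda\to[0,+\infty]$ is $$\mathrm I(\mu,Q)=\sum_{x\in E}\int_{[0,+\infty]}\mu(x,d\tau)\Big[\frac{\mathbf H(p^Q_{x,\cdot}\,|\,p_{x,\cdot})+\mathbf H(\psi^\mu_x\,|\,\psi_x)}{\tau}+\xi(x)\mathbf 1_{\{\infty\}}(\tau)\Big]$$ if $(\mu,Q)\in\Lambda_0$, and $\mathrm I(\mu,Q)=+\infty$ otherwise. *)

(* Defs.v *)
From HB Require Import structures.
From mathcomp Require Import all_boot all_order all_algebra.
From mathcomp Require Import all_classical all_reals all_analysis.

Set Implicit Arguments.
Unset Strict Implicit.
Unset Printing Implicit Defensive.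

Import Order.TTheory GRing.Theory Num.Theory.
Import numFieldNormedType.Exports.

Local Open Scope classical_set_scope.
Local Open Scope ring_scope.

(* Types with a topology and a sigma-algebra. The definitions below are only
   meaningful when the latter is the Borel one, which holds for the three
   instances in use: see [discrete_borel], [ebar_borel] and [prod_borel]. *)
#[short(type="topMeasurableType")]
HB.structure Definition TopMeasurable d :=
  {T of Topological T & Measurable d T}.

HB.instance Definition _ d1 d2 (T1 : topMeasurableType d1)
  (T2 : topMeasurableType d2) := Measurable.on (T1 * T2)%type.

(* Measurable spaces are pointed in the library, so a finite state space has to
   be a pointed (that is, nonempty) finite type. *)
#[short(type="finPointedType")]
HB.structure Definition FinPointed := {T of Finite T & Pointed T}.

HB.instance Definition _ (E : finType) := Finite.copy (discrete_topology E) E.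
HB.instance Definition _ (E : pointedType) :=
  @isMeasurable.Build default_measure_display (discrete_topology E)
    discrete_measurable discrete_measurable0
    discrete_measurableC discrete_measurableU.

(* [0, +oo], with the topology induced by the extended real line and the
   corresponding Borel sigma-algebra. *)
Definition ebar_nneg (R : realType) : Type := `[0%E, +oo%E : \bar R]%classic.

Section ebar_nneg_instances.
Context (R : realType).

Let ebar0 : ebar_nneg R.
Proof. by exists 0%E; rewrite inE /= in_itv /= lexx leey. Defined.

HB.instance Definition _ := Topological.copy (ebar_nneg R)
  (set_type `[0%E, +oo%E : \bar R]%classic).
HB.instance Definition _ := isPointed.Build (ebar_nneg R) ebar0.
HB.instance Definition _ := Measurable.copy (ebar_nneg R)
  (g_sigma_algebraType (@open (ebar_nneg R))).

End ebar_nneg_instances.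

Definition ebarval (R : realType) (t : ebar_nneg R) : \bar R := set_val t.

Definition real_nneg (R : realType) : Type := `[0 : R, +oo[%classic.
HB.instance Definition _ (R : realType) :=
  Uniform.copy (real_nneg R) (set_type `[0 : R, +oo[%classic).
Definition realval (R : realType) (t : real_nneg R) : R := set_val t.

Section borel.

Lemma discrete_borel (E : pointedType) :
  (measurable : set (set (discrete_topology E))) =
  <<s @open (discrete_topology E) >>.
Proof.
apply/seteqP; split=> [A _|//].
by apply: sub_sigma_algebra; exact: discrete_open.
Qed.

Lemma ebar_borel (R : realType) :
  (measurable : set (set (ebar_nneg R))) = <<s @open (ebar_nneg R) >>.
Proof. by []. Qed.

Lemma prod_borel (E : finPointedType) (R : realType) :
  (measurable : set (set (discrete_topology E * ebar_nneg R))) =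
  <<s @open (discrete_topology E * ebar_nneg R)%type >>.
Proof.
apply/seteqP; split.
  apply: smallest_sub; first exact: smallest_sigma_algebra.
  move=> _ [[A _ <-]|[B mB <-]]; rewrite setTI.
    apply: sub_sigma_algebra; apply: open_comp; last exact: discrete_open.
    by move=> ? _; exact: cvg_fst.
  have : sigma_algebra setT [set C : set (ebar_nneg R) |
      <<s @open (discrete_topology E * ebar_nneg R)%type >> (snd @^-1` C)].
    split => /=.
    - by rewrite preimage_set0; exact: sigma_algebra0.
    - move=> C mC; rewrite setTD preimage_setC -setTD.
      exact: sigma_algebraCD.
    - move=> F mF; rewrite preimage_bigcup; exact: sigma_algebra_bigcup.
  move=> sP; apply: (smallest_sub sP _ mB) => C oC /=.
  apply: sub_sigma_algebra; apply: open_comp => // ? _; exact: cvg_snd.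
apply: smallest_sub; first exact: sigma_algebra_measurable.
move=> O oO.
have -> : O = \bigcup_(x in [set: discrete_topology E])
    ([set x] `*` [set t | O (x, t)]).
  apply/seteqP; split=> [[x t] Oxt|[x t] [y _ [/= -> //]]].
  by exists x.
apply: fin_bigcup_measurable; first exact: finite_finset.
move=> x _; apply: measurableX => //; apply: sub_sigma_algebra.
apply: (@open_comp _ _ (fun t : ebar_nneg R => (x : discrete_topology E, t))).
  move=> t _ U [[A B] /= [nA nB] sU]; apply: filterS nB => s Bs; apply: sU.
  by split=> //=; exact: nbhs_singleton nA.
exact: oO.
Qed.

End borel.

Section narrow_topology.
Context d (T : topMeasurableType d) (R : realType).

Definition Cb : set (T -> R) := [set phi | continuous phi /\ bounded_fun phi].

(* The coarsest topology making [mu |-> \int[mu]_t phi t] continuous for every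
   continuous bounded phi. *)
Definition narrow : Type := initial_topology
  (fun (mu : probability T R) =>
     (fun phi => \int[mu]_t set_val phi t) : {ptws Cb -> R}).
HB.instance Definition _ := Topological.on narrow.

(* [nu] and [mu] are plain set functions so that the normalised measures of
   [pQ] and [psimu] can be plugged in directly; they are probability measures
   wherever the rate functional uses them (that is, on [Lambda0]). *)
Definition entropy (nu mu : set T -> \bar R) : \bar R :=
  ereal_sup [set (\int[nu]_t (phi t)%:E - lne (\int[mu]_t (expR (phi t))%:E))%E
            | phi in Cb].

End narrow_topology.
Arguments narrow {d} T R.

Section uniform_topology.
Context (X : topologicalType) (V : uniformType).

Definition unif_cts : Type :=
  initial_topology (fun f : continuousType X V => (f : {uniform X -> V})).
HB.instance Definition _ := Uniform.on unif_cts.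

End uniform_topology.

Section markov_kernel.
Context (R : realType) (E : finType).
Implicit Types p : E -> E -> R.

Definition markov_kernel p :=
  (forall x y, 0 <= p x y) /\ (forall x, \sum_(y : E) p x y = 1).

Fixpoint kernel_iter p (n : nat) (x y : E) : R :=
  if n is m.+1 then \sum_(z : E) p x z * kernel_iter p m z y else (x == y)%:R.

Definition irreducible p := forall x y, exists n, 0 < kernel_iter p n x y.

(* The measure on E with mass [w y] at [y]. *)
Definition weights (w : E -> R) (A : set (discrete_topology E)) : \bar R :=
  (\sum_(y : E | (y : discrete_topology E) \in A) (w y)%:E)%E.

End markov_kernel.

Section rate_functional.
Context (R : realType) (E : finPointedType).

Definition Lambda : Type :=
  (narrow (discrete_topology E * ebar_nneg R)%type R *
   unif_cts (discrete_topology E * discrete_topology E)%type (real_nneg R))%type.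
HB.instance Definition _ := Topological.on Lambda.

Implicit Types (p : E -> E -> R)
  (psi : E -> probability (ebar_nneg R) R)
  (mu : probability (discrete_topology E * ebar_nneg R)%type R)
  (Q : E -> E -> R).

(* mu(x, d tau), viewed as a measure on [0, +oo]. *)
Definition slice mu (x : E) (A : set (ebar_nneg R)) : \bar R :=
  mu ([set (x : discrete_topology E)] `*` A).

Definition flux (q : unif_cts (discrete_topology E * discrete_topology E)%type
    (real_nneg R)) (x y : E) : R :=
  realval ((q : continuousType _ _) (x, y)).

(* [inve] satisfies 0^-1 = +oo and +oo^-1 = 0. *)
Definition Lambda0 mu Q := forall x,
  (\int[slice mu x]_t (ebarval t)^-1)%E = (\sum_(y : E) Q x y)%:E /\
  \sum_(y : E) Q x y = \sum_(y : E) Q y x.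

Definition pQ p Q (x y : E) : R :=
  if [forall z, Q x z == 0] then p x y else Q x y / \sum_(z : E) Q x z.

Definition psimu psi mu Q (x : E) (A : set (ebar_nneg R)) : \bar R :=
  if [forall z, Q x z == 0] then psi x A
  else ((\sum_(z : E) Q x z)^-1%:E *
        \int[slice mu x]_(t in A) (ebarval t)^-1)%E.

Definition xi (nu : probability (ebar_nneg R) R) : \bar R :=
  ereal_sup [set c%:E | c in [set c : R | 0 <= c /\
    (\int[nu]_t expeR (c%:E * ebarval t) < +oo)%E]].

(* The product of [\bar R] satisfies 0 * +oo = 0. *)
Definition rate p psi (L : Lambda) : \bar R :=
  let mu : probability _ R := L.1 in
  let Q := flux L.2 in
  if `[< Lambda0 mu Q >] then
    (\sum_(x : E) \int[slice mu x]_t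
       ((entropy (weights (pQ p Q x)) (weights (p x)) +
         entropy (psimu psi mu Q x) (psi x)) / ebarval t +
        xi (psi x) * (\1_[set +oo%E] (ebarval t))%:E))%E
  else +oo%E.

End rate_functional.

(* Main.v *)
Require Import Defs.
From HB Require Import structures.
From mathcomp Require Import all_boot all_order all_algebra.
From mathcomp Require Import all_classical all_reals all_analysis.
From mathcomp Require Import measurable_realfun.
From mathcomp Require Import ring lra.

(** The compactness of a sublevel set of the rate is proved in the form: every
    ultrafilter W that contains the set converges to one of its points.

    On [Lambda0] the inverse time 1/tau integrates to the total flux
    Z x = sum_y Q x y, so the rate is the sum over the sites x of three costs:
    Z x times the entropy of the jump law, Z x times the entropy of the law of
    the holding time, and xi x times the mass of mu (x, .) at +oo
    ([rate_terms]). Multiplying the variational formula of the entropy by Z x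
    removes the normalisations: the holding cost is the supremum over bounded
    continuous f of
      \int mu (x, dtau) f tau / tau - Z x * ln (\int psi_x e^f),
    which is linear in (mu, Q).

    Compactness. Laws on the compact space E * [0, +oo] always converge along
    an ultrafilter: each slice is a mass times the image of the uniform law by
    a quantile function, masses and quantile functions are [0, 1]-valued and
    so converge pointwise, and monotonicity is enough to pass to the limit in
    the integrals ([narrow_ultra_cvg]). For the fluxes, let f be
    K (1 - a tau)^+, where a is so large that ln (\int psi_x e^f) <= 1/2; this
    is possible because psi_x does not charge 0. For K = 1 the test bounds Z x
    ([site_flux_bound]); for K large it shows that the part of 1/tau above the
    level a has a small integral, uniformly on the sublevel set ([site_tail]).
    Thus 1/tau is uniformly integrable, and the integrals of f tau / tau
    converge to those of the limit, which therefore belongs to [Lambda0]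
    ([weighted_rec_cvg]).

    Lower semicontinuity. The tests above are continuous along W, but the mass
    at +oo is not: mass at large finite times may move to +oo in the limit, and
    its cost xi x has to be paid by the entropies before the limit. For c with
    \int psi_x e^(c tau) finite, the tests f + c min ((tau - n)^+, m), with
    m -> +oo, give
      \int mu f / tau + c \int mu (1 - n / tau)^+
          - Z ln (\int psi_x e^(f + c (tau - n)^+))
        <= Z * entropy + c * mu {+oo}
    ([site_mixed]). Its left-hand side is continuous along W, because
    (1 - n / tau)^+ is continuous on [0, +oo] with value 1 at +oo. At the limit
    point one lets n -> +oo by dominated convergence, which gives the test of f
    plus c times the mass at +oo ([site_recover]); the suprema over the jump
    tests, over f and over c rebuild the three costs ([cost_from_tests]). *)

Set Implicit Arguments.
Unset Strict Implicit.
Unset Printing Implicit Defensive.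

Import Order.TTheory GRing.Theory Num.Theory.
Import numFieldNormedType.Exports.

Local Open Scope classical_set_scope.
Local Open Scope ring_scope.

(** * The half-line [0, +oo] in a bounded coordinate *)

Section topology_lemmas.

Lemma cvg_initialP (S : choiceType) (U : topologicalType) (f : S -> U)
    (F : set_system S) (s : S) : Filter F ->
  (F --> (s : initial_topology f)) <-> (f @ F --> f s).
Proof.
move=> FF; split=> [cF|cF].
  move=> A /(@initial_continuous _ _ f s) ; exact: cF.
move=> A /= [_ [[B oB <-] Bfs sBA]].
have /cF : nbhs (f s) B by rewrite nbhsE; exists B.
exact: (@filterS _ F FF _ _ sBA).
Qed.

End topology_lemmas.

Section coordinates.
Context (R : realType).
Notation T := (ebar_nneg R).

Lemma ebarval_ge0 (t : T) : (0 <= ebarval t)%E.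
Proof. by have := set_valP t; rewrite /= in_itv /= => /andP[]. Qed.

Lemma continuous_ebarval : continuous (@ebarval R).
Proof. exact: initial_continuous. Qed.

Lemma continuous_contract : continuous (@contract R).
Proof. by move=> x; apply/cvg_ballP => e e0; exact: (nbhsx_ballx x e e0). Qed.

Lemma continuous_to_T (S : topologicalType) (f : S -> T) :
  continuous (fun s => ebarval (f s)) -> continuous f.
Proof. by move=> cf s; apply/cvg_initialP; exact: cf. Qed.

(** The coordinate t / (1 + t), with value 1 at +oo: it identifies [0, +oo] with
    [0, 1], where limits and distribution functions are those of real numbers. *)
Definition kap (t : T) : R := contract (ebarval t).

Lemma continuous_kap : continuous kap.
Proof.
move=> t; apply: continuous_comp; first exact: continuous_ebarval.
exact: continuous_contract.
Qed.

Lemma kap_ge0 t : 0 <= kap t.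
Proof. by rewrite -contract0 le_contract ebarval_ge0. Qed.

Lemma kap_le1 t : kap t <= 1.
Proof. by have := contract_le1 (ebarval t); rewrite ler_norml => /andP[]. Qed.

Fact lift_subproof (r : R) :
  expand (Num.max 0 r) \in (`[0%E, +oo%E : \bar R]%classic : set _).
Proof.
by rewrite inE /= in_itv /= leey andbT -expand0 le_expand// le_max lexx.
Qed.

(** Reals outside [0, 1] are sent to the nearest end of [0, +oo], which makes this
    inverse of [kap] total and continuous on the line. *)
Definition liftT (r : R) : T := SigSub (lift_subproof r).

Lemma ebarval_lift r : ebarval (liftT r) = expand (Num.max 0 r).
Proof. by []. Qed.

Lemma kapK t : liftT (kap t) = t.
Proof.
apply: val_inj => /=; rewrite max_r ?kap_ge0// contractK//.
Qed.

Lemma kap_lift r : kap (liftT r) = Num.min 1 (Num.max 0 r).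
Proof.
rewrite /kap ebarval_lift; have [r1|r1] := leP 1 (Num.max 0 r).
  by rewrite expand1.
by rewrite expandK// inE ger0_norm ?le_max ?lexx// ltW.
Qed.

Lemma continuous_lift : continuous liftT.
Proof.
apply: continuous_to_T => r; apply/cvg_ballP => e e0.
have cf : continuous (fun r : R => Num.min 1 (Num.max 0 r)).
  move=> s; apply: (@continuous_min R R^o (cst 1) (cst 0 \max id)).
    exact: cvg_cst.
  by apply: (@continuous_max R R^o (cst 0) id); [exact: cvg_cst|exact: cvg_id].
have /cvgr_dist_lt /(_ e e0) := cf r.
apply: filterS => s; rewrite -!kap_lift; exact.
Qed.

Lemma open_measurable_T (A : set T) : open A -> measurable A.
Proof. by move=> oA; exact: sub_sigma_algebra. Qed.

Lemma continuous_measurable_T (f : T -> R) : continuous f -> measurable_fun setT f.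
Proof.
move=> cf; apply: (measurability _ (measurable_realfun.RGenOpens.measurableE R)) => _ [_ [a [b ->] <-]].
rewrite setTI; apply: open_measurable_T; apply: open_comp => // t _; exact: cf.
Qed.

Lemma measurable_lift : measurable_fun setT liftT.
Proof.
move=> _; apply: (@measurability _ _ _ _ setT liftT (@open T)) => // _ [A oA <-].
rewrite setTI; apply: open_measurable; apply: open_comp => // r _.
exact: continuous_lift.
Qed.

Lemma measurable_ebarval : measurable_fun setT (@ebarval R).
Proof.
apply: (measurability _ (measurable_realfun.ErealGenOInfty.measurableE R)) => _ [_ [r ->] <-].
rewrite setTI; apply: open_measurable_T; apply: open_comp.
  by move=> t _; exact: continuous_ebarval.
by rewrite set_itvoy; exact: open_ereal_gt_ereal.
Qed.

End coordinates.

(** * Quantile functions *)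

Section quantile.
Context (R : realType).
Notation T := (ebar_nneg R).

Definition unif : probability (measurableTypeR R) R := uniform_prob (@ltr01 R).

Lemma unif_itv (a b : R) : 0 <= a -> a <= b -> b <= 1 ->
  unif `]a, b]%classic = (b - a)%:E.
Proof.
move=> a0 ab b1; rewrite /unif /= /uniform_prob.
rewrite (eq_integral (cst 1%E)).
  rewrite integral_cst//= mul1e lebesgue_measure_itv/= lte_fin.
  by case: ltgtP ab => // -> _; rewrite subrr.
move=> x; rewrite inE /= in_itv/= /uniform_pdf => /andP[ax xb].
by rewrite (ltW (le_lt_trans a0 ax)) (le_trans xb b1)/= subr0 invr1.
Qed.

(** Closed rays are stable under intersection and generate the Borel sets. *)
Lemma measure_rays_unique (m1 m2 : {finite_measure set (measurableTypeR R) -> \bar R}) :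
  (forall r, m1 `]-oo, r]%classic = m2 `]-oo, r]%classic) ->
  forall A, measurable A -> m1 A = m2 A.
Proof.
move=> m12; pose G := [set A | exists r : R, A = `]-oo, r]%classic].
move=> A mA; apply: (@measure_unique _ R (measurableTypeR R) G (fun n => `]-oo, n%:R]%classic)) => //.
- apply/seteqP; split.
    rewrite measurable_realfun.RGenOInfty.measurableE.
    apply: smallest_sub; first exact: smallest_sigma_algebra.
    move=> _ [x ->]; rewrite -setCitvl -setTD.
    by apply: sigma_algebraCD; apply: sub_sigma_algebra; exists x.
  apply: smallest_sub; first exact: sigma_algebra_measurable.
  by move=> _ [x ->]; exact: measurable_itv.
- move=> _ _ [x ->] [y ->]; exists (Num.min x y).
  by apply/seteqP; split => z /=; rewrite !in_itv/= le_min => /andP.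
- by move=> n; exists n%:R.
- by rewrite -subTset => x _; exists (Num.truncn x).+1 => //=; rewrite in_itv/= ltW// truncnS_gt.
- move=> _ [x ->]; exact: m12.
- by move=> n; rewrite ltey_eq fin_num_measure.
Qed.

Variable P : probability T R.

Definition cdfT (r : R) : R := fine (P [set t | kap t <= r]).

(** Capping the level s at 1 keeps the set nonempty, so that the function is
    monotone and [0, 1]-valued on the whole line. *)
Definition quantile (s : R) : R :=
  inf [set r | (0 <= r <= 1) /\ Num.min s 1 <= cdfT r].

Lemma measurable_kap : measurable_fun setT (@kap R).
Proof. apply: continuous_measurable_T; exact: continuous_kap. Qed.

Let mK r : measurable [set t : T | kap t <= r].
Proof.
have := measurable_kap measurableT (measurable_itv `]-oo, r]).
rewrite setTI (_ : _ @^-1` _ = [set t | kap t <= r])//.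
Qed.

Let PE r : P [set t | kap t <= r] = (cdfT r)%:E.
Proof. by rewrite fineK// fin_num_measure. Qed.

Lemma cdfT_le r r' : r <= r' -> cdfT r <= cdfT r'.
Proof.
move=> rr'; rewrite -lee_fin -!PE le_measure ?inE// => t /= tr.
exact: le_trans rr'.
Qed.

Lemma cdfT_lt0 r : r < 0 -> cdfT r = 0.
Proof.
move=> r0; rewrite /cdfT (_ : [set t | _] = set0) ?measure0//.
rewrite -subset0 => t /= /le_lt_trans /(_ r0); apply/negP.
by rewrite -leNgt kap_ge0.
Qed.

Lemma cdfT_ge1 r : 1 <= r -> cdfT r = 1.
Proof.
move=> r1; rewrite /cdfT (_ : [set t | _] = setT) ?probability_setT//.
by apply/seteqP; split => // t _ /=; rewrite (le_trans _ r1)// kap_le1.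
Qed.

Lemma cdfT_ge0 r : 0 <= cdfT r.
Proof. by rewrite fine_ge0. Qed.

Lemma cdfT_le1 r : cdfT r <= 1.
Proof. by rewrite -lee_fin -PE probability_le1. Qed.

Let QS s := [set r | (0 <= r <= 1) /\ Num.min s 1 <= cdfT r].

Let QS1 s : QS s 1.
Proof. by rewrite /QS/= ler01 lexx cdfT_ge1// ge_min lexx orbT. Qed.

Let QSlb s : has_lbound (QS s).
Proof. by exists 0 => r [/andP[]]. Qed.

Lemma quantile_ge0 s : 0 <= quantile s.
Proof. by apply: lb_le_inf; [exists 1; exact: (QS1 s)|move=> r [/andP[]]]. Qed.

Lemma quantile_le1 s : quantile s <= 1.
Proof. exact: (ge_inf (QSlb s) (QS1 s)). Qed.

Lemma quantile_nd : {homo quantile : x y / x <= y}.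
Proof.
move=> x y xy; apply: lb_le_inf; first by exists 1; exact: (QS1 y).
move=> r [r01 ry]; apply: (ge_inf (QSlb x)); split => //.
by apply: le_trans ry; rewrite le_min !ge_min lexx xy/= orbT.
Qed.

(** The adjunction between the quantile and the distribution function. From left
    to right it is the right-continuity of the latter, that is, the continuity
    of P from above along r + 1 / (n + 1). *)
Lemma quantile_le s r : 0 < s -> s <= 1 -> (quantile s <= r) = (s <= cdfT r).
Proof.
move=> s0 s1.
have [r0|r0] := ltP r 0.
  rewrite cdfT_lt0// leNgt (lt_le_trans r0 (quantile_ge0 s))/=.
  by rewrite leNgt s0.
have [r1|r1] := leP 1 r.
  by rewrite cdfT_ge1// s1 (le_trans (quantile_le1 _)).
apply/idP/idP => [qr|sr]; last first.
  by apply: (ge_inf (QSlb s)); rewrite /QS /= r0 ltW// ge_min sr.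
have key n : s <= cdfT (r + n.+1%:R^-1).
  have : quantile s < r + n.+1%:R^-1 by rewrite (le_lt_trans qr)// ltrDl.
  move/(inf_lt (ex_intro _ 1 (QS1 s))) => [e [_]].
  rewrite min_l// => se er; apply: le_trans se _.
  exact/cdfT_le/ltW.
have : (fun n => P [set t | kap t <= r + n.+1%:R^-1]) @ \oo -->
    P (\bigcap_n [set t | kap t <= r + n.+1%:R^-1]).
  apply: nonincreasing_cvg_mu => //.
  - by rewrite ltey_eq fin_num_measure.
  - exact: bigcapT_measurable.
  - move=> m n mn; apply/subsetPset => t /= /le_trans; apply.
    by rewrite lerD2l lef_pV2 ?posrE// ler_nat.
have -> : \bigcap_n [set t : T | kap t <= r + n.+1%:R^-1] = [set t | kap t <= r].
  apply/seteqP; split => t /= h; last by move=> n _ /=; rewrite (le_trans h)// lerDl.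
  apply/ler_addgt0Pr => e e0.
  have /= := h (Num.truncn e^-1) I; move/le_trans; apply.
  by rewrite lerD2l -[leRHS]invrK lef_pV2 ?posrE ?invr_gt0// ltW// truncnS_gt.
move=> cv; rewrite -lee_fin -PE.
rewrite -(cvg_lim _ cv)//; apply: lime_ge; first by apply/cvg_ex; eexists; exact: cv.
by apply: nearW => n; rewrite PE lee_fin.
Qed.

Lemma measurable_quantile : measurable_fun setT quantile.
Proof. exact: (nondecreasing_measurable measurableT quantile_nd). Qed.

Let qf : {mfun measurableTypeR R >-> measurableTypeR R} :=
  HB.pack (quantile : measurableTypeR R -> measurableTypeR R)
   (@isMeasurableFun.Build _ _ (measurableTypeR R) (measurableTypeR R) quantile
     measurable_quantile).

Let kf : {mfun T >-> measurableTypeR R} :=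
  HB.pack (@kap R : T -> measurableTypeR R)
   (@isMeasurableFun.Build _ _ T (measurableTypeR R) (@kap R) measurable_kap).

(** By [quantile_le] the quantile function is at most r exactly on ]0, cdfT r], up
    to points that the uniform law does not charge. *)
Lemma quantile_law (A : set (measurableTypeR R)) : measurable A ->
  distribution unif qf A = distribution P kf A.
Proof.
apply: measure_rays_unique => r.
transitivity (cdfT r)%:E; last first.
  rewrite -PE; change (P [set t | kap t <= r] = P (@kap R @^-1` `]-oo, r]%classic)).
  by congr (P _); apply/seteqP; split => t /=; rewrite in_itv.
pose B : set (measurableTypeR R) := quantile @^-1` `]-oo, r]%classic.
change (unif B = (cdfT r)%:E).
have mB : measurable B by rewrite -[B]setTI; exact: measurable_quantile.
have u1 : unif `]0, 1]%classic = 1%E by rewrite unif_itv ?subr0.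
have -> : unif B = unif (B `&` `]0, 1]%classic).
  apply/eqP; rewrite eq_le; apply/andP; split; last first.
    by rewrite le_measure ?inE//; exact: measurableI.
  rewrite -{1}(setIT B) -(setUv `]0, 1]%classic) setIUr.
  apply: le_trans (measureU2 _ _ _) _; [exact: measurableI| |].
    by apply: measurableI => //; exact: measurableC.
  rewrite -[leRHS]adde0 leeD2l//.
  apply: (@le_trans _ _ (unif (~` `]0, 1]%classic))).
    by rewrite le_measure ?inE//; [apply: measurableI => //|]; exact: measurableC.
  by rewrite probability_setC// u1 subee.
have -> : B `&` `]0, 1]%classic = `]0, cdfT r]%classic.
  apply/seteqP; split => s; rewrite /B /= !in_itv/=.
    by move=> [qs /andP[s0 s1]]; rewrite s0/= -quantile_le.
  move=> /andP[s0 sr]; have s1 := le_trans sr (cdfT_le1 r).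
  by rewrite s0 s1 quantile_le.
by rewrite unif_itv ?subr0// ?cdfT_ge0 ?cdfT_le1.
Qed.

Lemma integral_quantile (f : T -> R) : measurable_fun setT f -> bounded_fun f ->
  \int[P]_t f t = \int[unif]_s f (liftT (quantile s)).
Proof.
move=> mf bf; congr fine.
have mfl : measurable_fun setT (f \o @liftT R).
  exact: (measurableT_comp mf (@measurable_lift R)).
have bfl (X : Type) (g : X -> T) : bounded_fun (f \o g).
  move: bf => [M [Mr hM]]; exists M; split => // x Mx y _; exact: hM.
transitivity (\int[distribution P kf]_x (EFin \o (f \o @liftT R)) x)%E.
  rewrite integral_distribution//.
  - by apply: eq_integral => t _ /=; rewrite kapK.
  - exact/measurable_EFinP.
  - apply: measurable_bounded_integrable => //.
    + by rewrite ltey_eq fin_num_measure.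
    + exact: (measurableT_comp mfl measurable_kap).
    + exact: (bfl _ (@liftT R \o @kap R)).
rewrite (eq_measure_integral (distribution unif qf)).
  rewrite integral_distribution//.
  - exact/measurable_EFinP.
  - apply: measurable_bounded_integrable => //.
    + by rewrite ltey_eq fin_num_measure.
    + exact: (measurableT_comp mfl measurable_quantile).
    + exact: (bfl _ (@liftT R \o quantile)).
move=> A mA _; exact/esym/quantile_law.
Qed.

End quantile.

(** * Integrals of monotone functions that converge pointwise *)

Section monotone_limits.
Context (R : realType).

(** Uniform continuity on [0, 1] settles the pairs at distance less than some d;
    for the others the bound H is enough, with slope C = 2 H / d. The result is
    affine in the distance, so that it can be integrated. *)
Lemma affine_modulus (h : R -> R) (H : R) : continuous h ->
  (forall s, `|h s| <= H) ->
  forall e : R, 0 < e -> exists2 C, 0 <= C &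
    forall a b, 0 <= a <= 1 -> 0 <= b <= 1 -> `|h a - h b| <= e + C * `|a - b|.
Proof.
move=> ch hH e e0.
have H0 : 0 <= H by apply: le_trans (hH 0).
have : \forall d \near 0^'+, `[0, 1]%classic `<=`
    [set a | forall b, `|a - b| < d -> `|h a - h b| <= e].
  have /compact_near_coveringP/near_covering_withinP := @segment_compact R 0 1.
  apply => x _.
  have /cvgr_dist_lt /(_ (e / 2)) := ch x; rewrite divr_gt0// => /(_ erefl).
  move=> /nbhs_ballP[r /= r0 xr].
  exists (ball x (r / 2), [set d | d < r / 2]) => /=.
    split; first by apply: nbhsx_ballx; rewrite divr_gt0.
    by apply: nbhs_right_lt; rewrite divr_gt0.
  move=> [a d] /= [xa dr] _ b abd.
  have ha := xr a; have hb := xr b.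
  have {}ha : `|h x - h a| < e / 2.
    by apply: ha; apply: le_ball xa; rewrite ler_pdivrMr// ler_peMr ?ltW// ltr1n.
  have {}hb : `|h x - h b| < e / 2.
    apply: hb; rewrite /ball /= (splitr r).
    by rewrite (le_lt_trans (ler_distD a _ _))// ltrD// (lt_trans abd).
  rewrite (le_trans (ler_distD (h x) _ _))// (splitr e) lerD//; last exact: ltW.
  by rewrite distrC ltW.
move=> nd.
have [d d0 hd] : exists2 d, 0 < d & `[0, 1]%classic `<=`
    [set a | forall b, `|a - b| < d -> `|h a - h b| <= e].
  near ((0 : R)^'+) => d; exists d => //.
  by near: d.
exists (H * 2 / d); first by rewrite divr_ge0// ?mulr_ge0// ltW.
move=> a b a01 _.
have [abd|abd] := ltP `|a - b| d.
  apply: (@le_trans _ _ e); last by rewrite lerDl mulr_ge0// divr_ge0 ?mulr_ge0// ltW.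
  by apply: hd.
apply: (@le_trans _ _ (H * 2)).
  by rewrite (le_trans (ler_normB _ _))// mulr_natr mulr2n lerD.
rewrite -[leLHS]add0r lerD//; first exact: ltW.
by rewrite -!mulrA ler_wpM2l// ler_peMr// mulrC ler_pdivlMr// mul1r.
Unshelve. all: by end_near. Qed.

(** Dominated convergence is not available along a general filter. Monotonicity
    replaces it: closeness at the grid points k / n, finitely many conditions,
    implies closeness on each cell up to the increment d k of g0 there, and the
    increments add up to at most 1, so that they contribute at most 1 / n to the
    integral. *)
Lemma cvg_integral_monotone (I : Type) (W : set_system I) (FW : ProperFilter W)
    (g : I -> R -> R) (g0 : R -> R) (h : R -> R) (H : R) :
  (forall i, {homo g i : x y / x <= y}) -> {homo g0 : x y / x <= y} ->
  (forall i s, 0 <= g i s <= 1) -> (forall s, 0 <= g0 s <= 1) ->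
  (forall s, g i s @[i --> W] --> g0 s) ->
  continuous h -> (forall s, `|h s| <= H) ->
  \int[@unif R]_s h (g i s) @[i --> W] --> \int[@unif R]_s h (g0 s).
Proof.
move=> gnd g0nd g01 g001 gcv ch hH.
have H0 : 0 <= H by apply: le_trans (hH 0).
apply/cvgrPdist_le => e e0.
have e20 : 0 < e / 2 by rewrite divr_gt0.
have [C C0 hC] := affine_modulus ch hH e20.
(* e / 2 is for the modulus, e / 4 for the errors at the grid points, and e / 4
   for the increments between them *)
pose eta := e / 4 / (C + 1).
have C1 : 0 < C + 1 by rewrite ltr_wpDl.
have eta0 : 0 < eta by rewrite !divr_gt0.
have Ceta : C * eta <= e / 4.
  by rewrite /eta mulrCA ler_piMr ?divr_ge0 ?ltW// ltr_pdivrMr// mul1r ltrDl.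
pose n := (Num.truncn eta^-1).+1.
have neta : n%:R^-1 <= eta :> R.
  by rewrite -[leRHS]invrK lef_pV2 ?posrE ?invr_gt0// ltW// truncnS_gt.
pose x (k : nat) : R := k%:R / n%:R.
pose d (k : nat) : R := g0 (x k.+1) - g0 (x k).
pose J (k : nat) : set (measurableTypeR R) := `]x k, x k.+1]%classic.
(* the increment of g0 over the grid cell of s; the cells cover ]0, 1] *)
pose osc (s : R) : R := \sum_(k < n) d k * \1_(J k) s.
have xlt k : x k < x k.+1 by rewrite ltr_pM2r ?invr_gt0 ?ltr0n// ltr_nat.
have d0 k : 0 <= d k by rewrite subr_ge0 g0nd// ltW.
pose D : set (measurableTypeR R) := `]0, 1]%classic.
have key : \forall i \near W, forall k : 'I_n.+1, `|g0 (x k) - g i (x k)| <= eta.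
  by apply: filter_forall => k; have /cvgrPdist_le /(_ _ eta0) := gcv (x k).
apply: filterS key => i gi.
have ptw s : `|h (g0 s) - h (g i s)| <=
    (e / 2 + C * eta) + (C * osc s + H * 2 * \1_(~` D) s).
  have osc0 : 0 <= osc s by apply: sumr_ge0 => k _; rewrite mulr_ge0.
  have [sD|sD] := boolP (s \in D); last first.
    rewrite indicE in_setC sD mulr1.
    apply: (@le_trans _ _ (H * 2)).
      by rewrite (le_trans (ler_normB _ _))// mulr_natr mulr2n lerD.
    rewrite addrA lerDr !addr_ge0//; [exact: ltW|apply: mulr_ge0 => //; exact: ltW|exact: mulr_ge0].
  rewrite indicE in_setC sD mulr0 addr0 -addrA -mulrDr.
  apply: (le_trans (hC _ _ (g001 s) (g01 i s))).
  rewrite lerD2l ler_wpM2l//.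
  move: sD; rewrite inE /D/= in_itv/= => /andP[s0 s1].
  have [k [kn xks sxk]] : exists k, [/\ (k < n)%N, x k < s & s <= x k.+1].
    have ex : exists m, s <= x m by exists n; rewrite /x divff ?pnatr_eq0.
    have [m sm mmin] := ex_minnP ex.
    case: m => [|k] in sm mmin *.
      by move: sm; rewrite /x mul0r leNgt s0.
    exists k; split => //.
      by apply: (mmin n); rewrite /x divff ?pnatr_eq0.
    by rewrite ltNge; apply/negP => /mmin; rewrite ltnn.
  have dosc : d k <= osc s.
    rewrite /osc (bigD1 (Ordinal kn))//= indicE mem_set ?mulr1; last first.
      by rewrite /J /= in_itv/= xks.
    by rewrite lerDl sumr_ge0// => j _; rewrite mulr_ge0.
  apply: (@le_trans _ _ (eta + d k)); last by rewrite lerD2l.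
  have gk := gi (Ordinal (leqW kn)); have gk1 := gi (Ordinal (kn : k.+1 < n.+1)%N).
  move: gk gk1 => /=; rewrite !ler_distl => /andP[a1 a2] /andP[b1 b2].
  have := g0nd _ _ (ltW xks); have := g0nd _ _ sxk.
  have := gnd i _ _ (ltW xks); have := gnd i _ _ sxk.
  by rewrite /d; lra.
have mh : measurable_fun setT h by exact: continuous_measurable_fun.
have mhg (f : R -> R) : {homo f : x y / x <= y} -> measurable_fun setT (h \o f).
  by move=> fnd; apply: measurableT_comp => //; exact: nondecreasing_measurable.
have ihg (f : R -> R) : {homo f : x y / x <= y} ->
    (@unif R).-integrable setT (EFin \o (h \o f)).
  move=> fnd; apply: measurable_bounded_integrable => //.
  - by rewrite ltey_eq fin_num_measure.
  - exact: mhg.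
  - exists H; split; first exact: num_real.
    by move=> M HM y _ /=; rewrite (le_trans (hH _))// ltW.
rewrite -RintegralB//; [|exact: ihg..].
have ih : (@unif R).-integrable setT (EFin \o (fun s => h (g0 s) - h (g i s))).
  have := integrableB measurableT (ihg _ g0nd) (ihg _ (gnd i)).
  by apply: eq_integrable => // s _ /=; rewrite EFinB.
apply: (le_trans (le_normr_Rintegral _ _)) => //.
rewrite -lee_fin fineK; last first.
  by apply: integrable_fin_num => //; exact: integrable_norm.
pose B s := ((e / 2 + C * eta)%:E +
  (C%:E * (\sum_(k < n) (d k)%:E * (\1_(J k) s)%:E) +
   (H * 2)%:E * (\1_(~` D) s)%:E))%E.
have mJ0 k : measurable (J k) by exact: measurable_itv.
have mD0 : measurable (~` D) by apply: measurableC; exact: measurable_itv.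
have mJ k : measurable_fun (setT : set (measurableTypeR R)) (fun s => (\1_(J k) s : R)%:E).
  by apply/measurable_EFinP; exact: measurable_indic.
have mD : measurable_fun (setT : set (measurableTypeR R)) (fun s => (\1_(~` D) s : R)%:E).
  by apply/measurable_EFinP; exact: measurable_indic.
have ind0 (A : set (measurableTypeR R)) s : (0 <= (\1_A s : R)%:E)%E.
  by rewrite lee_fin.
have dJ0 k s : (0 <= (d k)%:E * (\1_(J k) s)%:E)%E.
  by rewrite mule_ge0// lee_fin.
have s0 s : (0 <= \sum_(k < n) (d k)%:E * (\1_(J k) s)%:E)%E.
  by apply: sume_ge0.
have mdJ k : measurable_fun (setT : set (measurableTypeR R))
    (fun s => ((d k)%:E * (\1_(J k) s)%:E)%E).
  exact: measurable_funeM.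
have mS : measurable_fun (setT : set (measurableTypeR R))
    (fun s => (\sum_(k < n) (d k)%:E * (\1_(J k) s)%:E)%E).
  by apply: (@emeasurable_sum _ (measurableTypeR R) R setT _ _ (fun (k : 'I_n) s => (d k)%:E * (\1_(J k) s)%:E)%E) => k; exact: mdJ.
have E1 : 0 <= e / 2 + C * eta.
  by rewrite addr_ge0//; [exact: ltW|rewrite mulr_ge0//; exact: ltW].
have mB2 : measurable_fun (setT : set (measurableTypeR R)) (fun s =>
    (C%:E * (\sum_(k < n) (d k)%:E * (\1_(J k) s)%:E) +
   (H * 2)%:E * (\1_(~` D) s)%:E)%E).
  by apply: emeasurable_funD; exact: measurable_funeM.
have B20 s : (0 <= C%:E * (\sum_(k < n) (d k)%:E * (\1_(J k) s)%:E) +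
   (H * 2)%:E * (\1_(~` D) s)%:E)%E.
  by rewrite adde_ge0// mule_ge0// lee_fin mulr_ge0.
have H20 : 0 <= H * 2 by rewrite mulr_ge0.
apply: (@le_trans _ _ (\int[@unif R]_s B s)%E).
  apply: ge0_le_integral => //.
  - apply/measurable_EFinP; apply: measurableT_comp => //.
    by have /measurable_EFinP := measurable_int _ ih.
  - by apply: emeasurable_funD.
  - move=> s _; rewrite /B sumEFin//= lee_fin; exact: ptw.
rewrite /B ge0_integralD//.
rewrite ge0_integralD//; [|by move=> s _; rewrite mule_ge0|exact: measurable_funeM
  |by move=> s _; rewrite mule_ge0|exact: measurable_funeM].
rewrite integral_cst// ge0_integralZl// ge0_integralZl//.
rewrite ge0_integral_sum//.
rewrite (eq_bigr (fun k : 'I_n => (d k * n%:R^-1)%:E)); last first.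
  move=> k _; rewrite (_ : integral _ _ _ = (d k)%:E * \int[@unif R]_s (\1_(J k) s : R)%:E)%E; last first.
    by apply: ge0_integralZl => //; rewrite lee_fin; exact: d0.
  rewrite integral_indic// setIT EFinM; congr (_ * _)%E.
  have -> : n%:R^-1 = x k.+1 - x k.
    by rewrite /x -mulrBl -natrB// subSnn mul1r.
  apply: unif_itv; first by rewrite divr_ge0.
    exact/ltW/xlt.
  by rewrite ler_pdivrMr ?ltr0n// mul1r ler_nat.
have uD : @unif R (~` D) = 0%E.
  rewrite probability_setC; last exact: measurable_itv.
  by rewrite unif_itv// subr0 subee.
rewrite sumEFin integral_indic// setIT.
rewrite [X in ((H * 2)%:E * X)%E](_ : _ = 0%E)//.
rewrite mule0 adde0 [X in (_ * X)%E](_ : _ = 1%E); last exact: probability_setT.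
rewrite mule1 -EFinM -EFinD lee_fin.
rewrite -mulr_suml -(big_mkord predT) telescope_sumr//.
have := g001 (x n); have := g001 (x 0%N) => /andP[a0 _] /andP[_ b0].
have a1 : (g0 (x n) - g0 (x 0%N)) / n%:R <= eta.
  apply: le_trans neta; rewrite ler_piMl ?invr_ge0//.
  by rewrite lerBlDr (le_trans b0)// lerDl.
have := ler_wpM2l C0 a1.
by move: Ceta; lra.
Qed.

End monotone_limits.

(** * Slices and mixtures over a finite state space *)

Section slices.
Context (R : realType) (E : finPointedType).
Notation T := (ebar_nneg R).
Notation X := (discrete_topology E * ebar_nneg R)%type.

Lemma measurable_pairT (x : discrete_topology E) : measurable_fun setT (fun t : T => (x, t) : X).
Proof. exact: pair1_measurable. Qed.

Lemma measurable_sliceX (x : E) (A : set T) : measurable A ->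
  measurable ([set (x : discrete_topology E)] `*` A).
Proof. by move=> mA; exact: measurableX. Qed.

Section slice_measure.
Variables (mu : probability X R) (x : E).

Let slice0 : slice mu x set0 = 0%E.
Proof. by rewrite /slice setX0 measure0. Qed.

Let slice_ge0 A : (0 <= slice mu x A)%E.
Proof. exact: measure_ge0. Qed.

Let slice_sigma_additive : semi_sigma_additive (slice mu x).
Proof.
move=> F mF tF mUF; rewrite /slice setX_bigcupr.
apply: measure_semi_sigma_additive.
- by move=> n; exact: measurable_sliceX.
- apply/trivIsetP => /= i j _ _ ij; move/trivIsetP : tF => /(_ _ _ I I ij) Fij.
  by rewrite -subset0 => -[y t] /= [[_ Fi] [_ Fj]]; have : (F i `&` F j) t by []; rewrite Fij.
- by rewrite -setX_bigcupr; exact: measurable_sliceX.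
Qed.

HB.instance Definition _ := isMeasure.Build _ _ _ (slice mu x)
  slice0 slice_ge0 slice_sigma_additive.

Let slice_finite : fin_num_fun (slice mu x).
Proof. by move=> A mA; rewrite fin_num_measure//; exact: measurable_sliceX. Qed.

HB.instance Definition _ := Measure_isFinite.Build _ _ _ (slice mu x) slice_finite.

End slice_measure.

Section injm.
Variables (m : {measure set T -> \bar R}) (x : E).

(** The image of a measure on [0, +oo] in the fibre over x. *)
Definition injm (A : set X) : \bar R := m [set t | A (x, t)].

Let injm0 : injm set0 = 0%E.
Proof. by rewrite /injm (_ : [set t | _] = set0) ?measure0. Qed.

Let injm_ge0 A : (0 <= injm A)%E.
Proof. exact: measure_ge0. Qed.

Let mpre (A : set X) : measurable A -> measurable [set t | A (x, t)].
Proof. by move=> mA; rewrite -[X in measurable X]setTI; exact: measurable_pairT. Qed.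

Let injm_sigma_additive : semi_sigma_additive injm.
Proof.
move=> F mF tF mUF; rewrite /injm.
have -> : [set t | (\bigcup_n F n) (x, t)] = \bigcup_n [set t | F n (x, t)] by [].
apply: measure_semi_sigma_additive.
- by move=> n; exact: mpre.
- apply/trivIsetP => /= i j _ _ ij; move/trivIsetP : tF => /(_ _ _ I I ij) Fij.
  by rewrite -subset0 => t /= [Fi Fj]; have : (F i `&` F j) (x, t) by []; rewrite Fij.
- exact: (mpre mUF).
Qed.

HB.instance Definition _ := isMeasure.Build _ _ _ injm
  injm0 injm_ge0 injm_sigma_additive.

Lemma ge0_integral_injm (g : X -> \bar R) : measurable_fun setT g ->
  (forall z, 0 <= g z)%E ->
  (\int[injm]_z g z = \int[m]_t g (x, t))%E.
Proof.
move=> mg g0; have := @ge0_integral_pushforward _ _ _ _ R _ (measurable_pairT x) m setT g.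
by rewrite preimage_setT => <-.
Qed.

End injm.

(** The law with prescribed slices. The enumeration of E is there because finite
    sums of measures are indexed by an initial segment of the naturals. *)
Definition mix (nu : E -> {measure set T -> \bar R}) : set X -> \bar R :=
  msum (fun k => injm (nu (nth point (enum E) k)) (nth point (enum E) k)) #|E|.

HB.instance Definition _ nu := Measure.on (mix nu).

Lemma sum_nth_enum (U : nmodType) (F : E -> U) :
  \sum_(k < #|E|) F (nth point (enum E) k) = \sum_(x : E) F x.
Proof.
rewrite -[RHS]big_enum (big_nth point) big_mkord cardE.
by rewrite (_ : enum xpredT = enum E)//; exact: eq_enum.
Qed.

Lemma mixE nu (A : set X) : mix nu A = (\sum_(x : E) nu x [set t | A (x, t)])%E.
Proof. by rewrite -sum_nth_enum. Qed.

Lemma ge0_integral_mix nu (g : X -> \bar R) : measurable_fun setT g ->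
  (forall z, 0 <= g z)%E ->
  (\int[mix nu]_z g z = \sum_(x : E) \int[nu x]_t g (x, t))%E.
Proof.
move=> mg g0; rewrite ge0_integral_measure_sum//.
under eq_bigr do rewrite ge0_integral_injm//.
by rewrite (sum_nth_enum (fun x => \int[nu x]_t g (x, t))%E).
Qed.

Lemma slice_mix (mu : probability X R) (A : set X) : measurable A ->
  mix (slice mu) A = mu A.
Proof.
move=> mA; rewrite mixE /slice.
rewrite (bigfs _ (r := index_enum E) (P := xpredT))//; last 2 first.
- exact: index_enum_uniq.
- by move=> x _; rewrite mem_index_enum.
rewrite -(measure_fin_bigcup (mu : {measure set X -> \bar R})
  (F := fun x : E => [set (x : discrete_topology E)] `*` [set t | A (x, t)])).
- congr (mu _); apply/seteqP; split => [[x t] [y _ /= [-> //]]|[x t] Axt].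
  by exists x.
- exact: finite_finset.
- by move=> x y _ _ [[z t] /= [[<- _] [<- _]]].
- move=> x _; apply: measurable_sliceX.
  by rewrite -[X in measurable X]setTI; exact: (measurable_pairT x).
Qed.

Lemma bounded_fun_ex (U : Type) (f : U -> R) : bounded_fun f ->
  exists2 H, 0 <= H & forall u, `|f u| <= H.
Proof.
move=> [M [Mr hM]]; exists (`|M| + 1); first by rewrite addr_ge0.
by move=> u; apply: hM => //; rewrite ltr_pwDr// ler_norm.
Qed.

Lemma bounded_fun_intro (U : Type) (f : U -> R) H : (forall u, `|f u| <= H) ->
  bounded_fun f.
Proof.
move=> hH; exists H; split; first exact: num_real.
by move=> M HM u _ /=; rewrite (le_trans (hH _))// ltW.
Qed.

Lemma bounded_integrable d (U : measurableType d) (m : {measure set U -> \bar R})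
    (f : U -> R) : m setT \is a fin_num -> measurable_fun setT f -> bounded_fun f ->
  m.-integrable setT (EFin \o f).
Proof.
move=> mfin mf bf; apply: measurable_bounded_integrable => //.
by rewrite ltey_eq mfin.
Qed.

(** Reduces bounded functions to nonnegative ones, whose integrals are additive
    and monotone in the measure without integrability conditions. *)
Lemma Rintegral_shift d (U : measurableType d) (m : {measure set U -> \bar R})
    (f : U -> R) (H : R) :
  m setT \is a fin_num -> measurable_fun setT f -> (forall u, `|f u| <= H) ->
  \int[m]_u f u = fine (\int[m]_u (f u + H)%:E)%E - H * fine (m setT).
Proof.
move=> mfin mf fH.
have if1 : m.-integrable setT (EFin \o (fun u => f u + H)).
  apply: bounded_integrable => //; first exact: measurable_funD.
  apply: (@bounded_fun_intro _ _ (H + `|H|)) => u.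
  by rewrite (le_trans (ler_normD _ _))// lerD.
have if2 : m.-integrable setT (EFin \o (cst H)).
  apply: bounded_integrable => //.
  by apply: (@bounded_fun_intro _ _ `|H|).
rewrite -Rintegral_cst// -/(Rintegral _ _ _) -RintegralB//.
by apply: eq_Rintegral => u _ /=; rewrite addrK.
Qed.

Lemma Rintegral_mix (nu : E -> {measure set T -> \bar R}) (g : X -> R) :
  (forall x, nu x setT \is a fin_num) -> measurable_fun setT g -> bounded_fun g ->
  \int[mix nu]_z g z = \sum_(x : E) \int[nu x]_t g (x, t).
Proof.
move=> nufin mg /[dup] bg /bounded_fun_ex[H H0 gH].
have mixT : mix nu setT = (\sum_(x : E) nu x setT)%E by rewrite mixE.
have mixfin : mix nu setT \is a fin_num by rewrite mixT sum_fin_num; apply/allP => _ /mapP[x _ ->]; exact: nufin.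
have mgx x : measurable_fun setT (fun t => g (x, t)).
  exact: (measurableT_comp mg (measurable_pairT x)).
have gH0 z : 0 <= g z + H by rewrite -lerBlDr sub0r; have := gH z; rewrite ler_norml => /andP[].
rewrite (Rintegral_shift _ _ gH)// ge0_integral_mix//; last first.
  by apply/measurable_EFinP; exact: measurable_funD.
rewrite [X in H * fine X]mixT -sum_fine//; last first.
  move=> x _; apply: integrable_fin_num => //.
  apply: (@bounded_integrable _ _ _ (fun t => g (x, t) + H)) => //; first exact: measurable_funD.
  apply: (@bounded_fun_intro _ _ (H + H)) => u.
  by rewrite (le_trans (ler_normD _ _))// lerD// ger0_norm.
rewrite -sum_fine// mulr_sumr -sumrB.
by apply: eq_bigr => x _; rewrite (@Rintegral_shift _ _ (nu x) _ H).
Qed.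

Lemma Rintegral_scale d (U : measurableType d) (m1 m2 : {measure set U -> \bar R})
    (c : R) (f : U -> R) : 0 <= c -> m2 setT \is a fin_num ->
  (forall A, measurable A -> m1 A = (c%:E * m2 A)%E) ->
  measurable_fun setT f -> bounded_fun f ->
  \int[m1]_u f u = c * \int[m2]_u f u.
Proof.
move=> c0 m2fin m12 mf /bounded_fun_ex[H H0 fH].
have m1fin : m1 setT \is a fin_num by rewrite m12// fin_numM.
have fH0 u : 0 <= f u + H by rewrite -lerBlDr sub0r; have := fH u; rewrite ler_norml => /andP[].
have mfH : measurable_fun setT (fun u => (f u + H)%:E).
  by apply/measurable_EFinP; exact: measurable_funD.
rewrite (Rintegral_shift m1fin mf fH) (Rintegral_shift m2fin mf fH) m12//.
rewrite (eq_measure_integral (mscale (NngNum c0) m2)); last first.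
  by move=> A mA _; rewrite m12.
rewrite ge0_integral_mscale//=; last by move=> u _; rewrite lee_fin.
have h2 : (\int[m2]_u (f u + H)%:E)%E \is a fin_num.
  apply: integrable_fin_num => //.
  apply: (@bounded_integrable _ _ _ (fun u => f u + H)) => //; first exact: measurable_funD.
  apply: (@bounded_fun_intro _ _ (H + H)) => u.
  by rewrite (le_trans (ler_normD _ _))// lerD// ger0_norm.
by rewrite !fineM//= mulrBr mulrCA.
Qed.

Lemma Rintegral_slice (mu : probability X R) (g : X -> R) :
  measurable_fun setT g -> bounded_fun g ->
  \int[mu]_z g z = \sum_(x : E) \int[slice mu x]_t g (x, t).
Proof.
move=> mg bg; rewrite -Rintegral_mix//.
  congr fine; apply: eq_measure_integral => A mA _.
  exact/esym/slice_mix.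
by move=> x; exact: fin_num_measure.
Qed.

End slices.

(** * Compactness of the space of laws *)

(** An ultrafilter converges to each of its cluster points. *)
Lemma ultra_cvg_compact (I : Type) (W : set_system I) (UW : UltraFilter W)
    (U : topologicalType) (K : set U) (f : I -> U) :
  compact K -> W (f @^-1` K) -> exists2 l, K l & f i @[i --> W] --> l.
Proof.
move=> cK WK.
have [l [Kl cl]] : K `&` cluster (f i @[i --> W]) !=set0 by apply: cK.
exists l => // A nA.
have [//|WA] := in_ultra_setVsetC (f @^-1` A) UW.
have [u [/= nAu Au]] := cl (~` A) A WA nA.
by [].
Qed.

Lemma cvg_prod_topologyP (I : choiceType) (V : topologicalType)
    (F : set_system (prod_topology (fun _ : I => V)))
    (f : prod_topology (fun _ : I => V)) : Filter F ->
  F --> f <-> forall i, g i @[g --> F] --> f i.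
Proof.
move=> FF; split=> [cF i|cF].
  apply: cvg_trans (@proj_continuous I (fun=> V) i f).
  exact: (cvg_app (proj i) cF).
apply/cvg_sup => i; apply/cvg_initialP; exact: cF.
Qed.

Lemma cvg_finsum (R : realType) (J : finType) (I : Type) (F : set_system I)
    (FF : Filter F) (f : J -> I -> R) (l : J -> R) :
  (forall j, f j i @[i --> F] --> l j) ->
  \sum_(j : J) f j i @[i --> F] --> \sum_(j : J) l j.
Proof.
move=> fl; elim: (index_enum J) => [|j s IH].
  rewrite big_nil (_ : (fun i => _) = cst 0); first exact: cvg_cst.
  by apply/funext => i; rewrite big_nil.
rewrite big_cons (_ : (fun i => _) = (fun i => f j i + \sum_(j <- s) f j i)).
  exact: cvgD.
by apply/funext => i; rewrite big_cons.
Qed.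

Section narrow_cvg.
Context d (U : topMeasurableType d) (R : realType).

Lemma narrow_cvgP (F : set_system (narrow U R)) (mu : narrow U R) : Filter F ->
  F --> mu <-> (forall phi : U -> R, Cb phi ->
    (\int[(nu : probability U R)]_u phi u) @[nu --> F] -->
    \int[(mu : probability U R)]_u phi u).
Proof.
move=> FF; split.
  move=> /cvg_initialP /cvg_prod_topologyP cF phi phiC.
  exact: (cF (SigSub (mem_set phiC))).
move=> h; apply/cvg_initialP; apply/cvg_prod_topologyP => phi.
exact: (h (set_val phi) (set_valP phi)).
Qed.

End narrow_cvg.

Section prokhorov.
Context (R : realType) (E : finPointedType).
Notation T := (ebar_nneg R).
Notation X := (discrete_topology E * ebar_nneg R)%type.

Lemma open_measurable_X (A : set X) : open A -> measurable A.
Proof. by move=> oA; rewrite prod_borel; exact: sub_sigma_algebra. Qed.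

Lemma continuous_measurable_X (f : X -> R) : continuous f -> measurable_fun setT f.
Proof.
move=> cf; apply: (measurability _ (measurable_realfun.RGenOpens.measurableE R)) => _ [_ [a [b ->] <-]].
rewrite setTI; apply: open_measurable_X; apply: open_comp => // t _; exact: cf.
Qed.

Lemma continuous_pairT (x : discrete_topology E) : continuous (fun t : T => (x, t) : X).
Proof.
move=> t U [[A B] /= [nA nB] sU]; apply: filterS nB => s Bs; apply: sU.
by split=> //=; exact: nbhs_singleton nA.
Qed.

Lemma continuous_sectionX (f : X -> R) (x : discrete_topology E) : continuous f ->
  continuous (fun t => f (x, t)).
Proof.
move=> cf t; apply: (@continuous_comp _ _ _ (fun t : T => (x, t) : X) f); last exact: cf.
exact: continuous_pairT.
Qed.

Lemma mix_probability (nu : E -> {measure set T -> \bar R}) :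
  mix nu setT = 1%E -> exists P : probability X R, forall A, P A = mix nu A.
Proof.
move=> nu1.
pose P : probability X R := HB.pack (mix nu)
  (Measure_isProbability.Build _ _ _ (mix nu) nu1).
by exists P.
Qed.

(** A slice is its mass times a probability measure, arbitrary if the mass is 0. *)
Lemma slice_quantile (mu : probability X R) (x : E) :
  exists q : R -> R, [/\ {homo q : s s' / s <= s'}, (forall s, 0 <= q s <= 1) &
    forall f : T -> R, measurable_fun setT f -> bounded_fun f ->
     \int[slice mu x]_t f t =
     fine (slice mu x setT) * \int[@unif R]_s f (liftT (q s))].
Proof.
(* the law used if the slice vanishes *)
pose P0 : probability T R := \d_(liftT 0).
pose P : probability T R := mnormalize (slice mu x) P0.
exists (quantile P); split.
- exact: quantile_nd.
- by move=> s; rewrite quantile_ge0 quantile_le1.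
move=> f mf bf; rewrite -integral_quantile//.
pose m := fine (slice mu x setT).
have mfin : slice mu x setT \is a fin_num by exact: fin_num_measure.
have m0 : 0 <= m by exact: fine_ge0.
have PE A : measurable A -> slice mu x A = (m%:E * P A)%E.
  move=> mA; have [s0|s0] := eqVneq (slice mu x setT) 0%E.
    rewrite /m s0 mul0e; apply/eqP; rewrite eq_le measure_ge0 andbT.
    by rewrite -s0 le_measure ?inE.
  have sy : slice mu x setT == +oo%E = false.
    by apply/negbTE; move: mfin; rewrite fin_numE => /andP[].
  have -> : P A = (slice mu x A * (m^-1)%:E)%E.
    by rewrite /P /= /mnormalize (negbTE s0) sy.
  by rewrite muleCA -EFinM divff ?mule1// /m fine_eq0.
by apply: (@Rintegral_scale R _ _ (slice mu x) P m) => //; exact: fin_num_measure.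
Qed.

Lemma measurable_lift_mono (q : R -> R) : {homo q : s s' / s <= s'} ->
  measurable_fun setT (fun s : measurableTypeR R => liftT (q s) : T).
Proof.
move=> qnd; apply: (measurableT_comp (@measurable_lift R)).
exact: (nondecreasing_measurable measurableT qnd).
Qed.

Lemma mono_probability (q : R -> R) : {homo q : s s' / s <= s'} ->
  exists P : probability T R, forall f : T -> R, measurable_fun setT f ->
    bounded_fun f -> \int[P]_t f t = \int[@unif R]_s f (liftT (q s)).
Proof.
move=> qnd.
pose X : {mfun measurableTypeR R >-> T} :=
  HB.pack (fun s : measurableTypeR R => liftT (q s) : T)
   (@isMeasurableFun.Build _ _ (measurableTypeR R) T _ (measurable_lift_mono qnd)).
exists (distribution (@unif R) X) => f mf bf.
congr fine; apply: (@integral_distribution _ _ _ _ _ _ X (EFin \o f)).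
  exact/measurable_EFinP.
apply: (@bounded_integrable R _ _ _ (f \o X)).
- exact: fin_num_measure.
- exact: measurableT_comp.
- have [H H0 fH] := bounded_fun_ex bf.
  by apply: (@bounded_fun_intro _ _ _ H) => u; exact: fH.
Qed.

(** Compactness of the space of laws on E * [0, +oo]. The masses of the slices and
    the values of their quantile functions lie in [0, 1], hence converge along
    the ultrafilter; the limits define slices, thus a law, and
    [cvg_integral_monotone] shows that the integrals converge to those of this
    law. *)
Lemma narrow_ultra_cvg (W : set_system (narrow X R)) : UltraFilter W ->
  exists mu : narrow X R, W --> mu.
Proof.
move=> UW.
have /choice[q hq] : forall mux : probability X R * E, exists q : R -> R,
  [/\ {homo q : s s' / s <= s'}, (forall s, 0 <= q s <= 1) &
    forall f : T -> R, measurable_fun setT f -> bounded_fun f ->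
     \int[slice mux.1 mux.2]_t f t =
     fine (slice mux.1 mux.2 setT) * \int[@unif R]_s f (liftT (q s))].
  by move=> [mu x]; exact: slice_quantile.
pose m (mu : narrow X R) (x : E) := fine (slice (mu : probability X R) x setT).
have m0 mu x : 0 <= m mu x by exact: fine_ge0.
have m1 mu : \sum_(x : E) m mu x = 1.
  have := @slice_mix R E mu setT measurableT.
  rewrite probability_setT mixE => /(congr1 fine) h.
  rewrite -[RHS]/(fine (1%:E : \bar R)) -h -sum_fine// => x _.
  by apply: (@fin_num_measure _ _ _ (slice (mu : probability X R) x)); exact: measurableT.
have mle mu x : m mu x <= 1.
  by rewrite -(m1 mu) (bigD1 x)//= lerDl sumr_ge0.
have /choice[mo hmo] : forall x, exists l : R, m mu x @[mu --> W] --> l.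
  move=> x; have W1 : W ((m^~ x) @^-1` `[0, 1]%classic).
    by apply: filterE => mu; rewrite /= in_itv/= m0 mle.
  by have [l _ hl] := ultra_cvg_compact UW (@segment_compact R 0 1) W1; exists l.
have /choice[qo hqo] : forall xs : E * R, exists l : R,
    q (mu : probability X R, xs.1) xs.2 @[mu --> W] --> l.
  move=> [x s].
  have W1 : W ((fun mu : narrow X R => q (mu : probability X R, x) s) @^-1`
      `[0, 1]%classic).
    apply: filterE => mu; rewrite /= in_itv/=.
    by have [_ h _] := hq (mu : probability X R, x); exact: h.
  by have [l _ hl] := ultra_cvg_compact UW (@segment_compact R 0 1) W1; exists l.
have mo0 x : 0 <= mo x.
  by apply: (cvgr_to_ge (hmo x)); exact: nearW.
have mo1 : \sum_(x : E) mo x = 1.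
  have h : \sum_(x : E) m mu x @[mu --> W] --> \sum_(x : E) mo x.
    by apply: cvg_finsum => x; exact: hmo.
  have h1 : \sum_(x : E) m mu x @[mu --> W] --> (1 : R).
    by apply: cvg_near_cst; apply: nearW => mu; rewrite m1.
  exact: (cvg_unique _ h h1).
have qond x : {homo (fun s => qo (x, s)) : s s' / s <= s'}.
  move=> s s' ss'; apply: (ler_cvg_to (hqo (x, s)) (hqo (x, s'))).
  by apply: nearW => mu; have [h _ _] := hq (mu : probability X R, x); exact: h.
have qo01 x s : 0 <= qo (x, s) <= 1.
  have h mu := let: And3 _ h _ := hq ((mu : narrow X R) : probability X R, x) in h s.
  apply/andP; split.
    by apply: (cvgr_to_ge (hqo (x, s))); apply: nearW => mu; case/andP: (h mu).
  by apply: (cvgr_to_le (hqo (x, s))); apply: nearW => mu; case/andP: (h mu).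
have /choice[P hP] : forall x : E, exists P : probability T R, forall f : T -> R,
    measurable_fun setT f -> bounded_fun f ->
    \int[P]_t f t = \int[@unif R]_s f (liftT (qo (x, s))).
  by move=> x; exact: mono_probability.
pose nu x : {measure set T -> \bar R} := mscale (NngNum (mo0 x)) (P x).
have nuT x : nu x setT = (mo x)%:E.
  by rewrite /nu/= /mscale/= probability_setT mule1.
have [mu muE] : exists mu : probability X R, forall A, mu A = mix nu A.
  apply: mix_probability; rewrite mixE; under eq_bigr do rewrite nuT.
  by rewrite sumEFin mo1.
exists (mu : narrow X R); apply/narrow_cvgP => phi [cphi bphi].
have mphi := continuous_measurable_X cphi.
have mphix (x : discrete_topology E) := continuous_measurable_T (continuous_sectionX (x := x) cphi).
have [H H0 phiH] := bounded_fun_ex bphi.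
have bphix (x : discrete_topology E) : bounded_fun (fun t => phi (x, t)).
  by apply: (@bounded_fun_intro _ _ _ H).
have -> : \int[mu]_u phi u = \sum_(x : E) mo x * \int[@unif R]_s phi (x, liftT (qo (x, s))).
  transitivity (\int[mix nu]_u phi u).
    by congr fine; apply: eq_measure_integral => A mA _; exact: muE.
  rewrite Rintegral_mix//; last by move=> x; rewrite nuT.
  apply: eq_bigr => x _; rewrite -(hP x _ (mphix x) (bphix x)).
  by apply: (@Rintegral_scale R _ _ (nu x) (P x)) => //; exact: fin_num_measure.
have phiE : (fun nu0 : narrow X R => \int[(nu0 : probability X R)]_u phi u) =
    (fun nu0 : narrow X R => \sum_(x : E) m nu0 x *
    \int[@unif R]_s phi (x, liftT (q (nu0 : probability X R, x) s))).
  apply/funext => nu0; rewrite Rintegral_slice//; apply: eq_bigr => x _.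
  have [_ _ h] := hq (nu0 : probability X R, x).
  exact: (h (fun t => phi (x, t)) (mphix x) (bphix x)).
rewrite phiE.
apply: cvg_finsum => x; apply: cvgM; first exact: hmo.
apply: (@cvg_integral_monotone R _ W _ (fun nu0 : narrow X R => q (nu0 : probability X R, x))
  (fun s => qo (x, s)) (fun r => phi (x, liftT r)) H) => //.
- by move=> nu0; have [h _ _] := hq (nu0 : probability X R, x).
- by move=> nu0; have [_ h _] := hq (nu0 : probability X R, x).
- by move=> s; exact: (hqo (x, s)).
- move=> r; apply: (@continuous_comp _ _ _ (@liftT R) (fun t => phi (x, t))).
    exact: continuous_lift.
  exact: continuous_sectionX.
Qed.

End prokhorov.

(** * Measures with a density *)

Section density.
Context d (U : measurableType d) (R : realType).
Variables (m : {measure set U -> \bar R}) (g : U -> \bar R).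
Hypotheses (mg : measurable_fun setT g) (g0 : forall u, (0 <= g u)%E).

Definition dens (A : set U) : \bar R := (\int[m]_(u in A) g u)%E.

Let dens0 : dens set0 = 0%E.
Proof. by rewrite /dens integral_set0. Qed.

Let dens_ge0 A : (0 <= dens A)%E.
Proof. by apply: integral_ge0. Qed.

Let dens_sigma_additive : semi_sigma_additive dens.
Proof.
move=> /= F mF tF mUF; rewrite /dens; apply: cvg_toP.
  apply: ereal_nondecreasing_is_cvgn => k n kn.
  apply: lee_sum_nneg_natr => // i _ _.
  exact: integral_ge0.
by rewrite ge0_integral_bigcup//=; exact: measurable_funTS.
Qed.

Definition dens_measure : {measure set U -> \bar R} :=
  HB.pack dens (isMeasure.Build _ _ _ dens dens0 dens_ge0 dens_sigma_additive).

Import HBNNSimple.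

(** The definition settles indicators, linearity simple functions, and monotone
    approximation the general case. *)
Lemma ge0_integral_dens (f : U -> R) : measurable_fun setT f ->
  (forall u, 0 <= f u) ->
  (\int[dens_measure]_u (f u)%:E = \int[m]_u ((f u)%:E * g u))%E.
Proof.
move=> mf f0.
have mEf : measurable_fun setT (EFin \o f) by exact/measurable_EFinP.
have Ef0 u : setT u -> (0 <= (EFin \o f) u)%E by move=> _; rewrite lee_fin.
pose f_ := nnsfun_approx measurableT mEf.
have f_cvg y : (f_ n y)%:E @[n --> \oo] --> (f y)%:E.
  exact: (cvg_nnsfun_approx measurableT mEf Ef0).
have simple (h : {nnsfun U >-> R}) :
    (\int[dens_measure]_u (h u)%:E = \int[m]_u ((h u)%:E * g u))%E.
  under eq_integral do rewrite fimfunE -fsumEFin//.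
  rewrite ge0_integral_fsum//; last 2 first.
  - by move=> r; apply/measurable_EFinP; exact: measurable_funM.
  - by move=> r x _; rewrite nnfun_muleindic_ge0.
  under [RHS]eq_integral => x _.
    rewrite fimfunE -fsumEFin// ge0_mule_fsuml; last first.
      by move=> r; rewrite nnfun_muleindic_ge0.
    over.
  rewrite [RHS]ge0_integral_fsum//; last 2 first.
  - move=> r; apply: emeasurable_funM => //.
    by apply/measurable_EFinP; exact: measurable_funM.
  - by move=> r x _; rewrite mule_ge0// nnfun_muleindic_ge0.
  apply: eq_fsbigr => r; rewrite inE => -[u _ hr].
  have r0 : 0 <= r by rewrite -hr.
  rewrite integralZl_indic_nnsfun// integral_indic//= setIT.
  under eq_integral do rewrite EFinM -muleA.
  rewrite ge0_integralZl//; last 2 first.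
  - apply: emeasurable_funM => //.
    by apply/measurable_EFinP; exact: measurable_indic.
  - by move=> v _; rewrite mule_ge0// lee_fin.
  congr (_ * _)%E; rewrite /dens_measure /= /dens integral_mkcond.
  apply: eq_integral => v _; rewrite patchE indicE.
  by case: ifPn => _; rewrite ?mul1e ?mul0e.
transitivity (limn (fun n => \int[dens_measure]_x (f_ n x)%:E))%E.
  rewrite -monotone_convergence//.
  - by apply: eq_integral => y _; apply/esym/cvg_lim => //; exact: f_cvg.
  - by move=> n; exact/measurable_EFinP/measurable_funP.
  - by move=> n y _; rewrite lee_fin.
  - by move=> y _ i n mn; rewrite lee_fin; exact/lefP/nd_nnsfun_approx.
under eq_fun do rewrite simple.
have f_le n y : ((f_ n y)%:E <= (f y)%:E)%E.
  have nd : {homo (fun n => (f_ n y)%:E) : i j / (i <= j)%N >-> (i <= j)%E}.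
    by move=> i j ij; rewrite lee_fin; exact/lefP/nd_nnsfun_approx.
  rewrite -(cvg_unique _ (ereal_nondecreasing_cvgn nd) (f_cvg y))//.
  by apply: ereal_sup_ubound; exists n.
rewrite -monotone_convergence//.
- apply: eq_integral => y _; apply/cvg_lim => //.
  have [fy0|fy0] := eqVneq (f y) 0.
    rewrite fy0 mul0e; apply: cvg_near_cst; apply: nearW => n.
    suff -> : f_ n y = 0 by rewrite mul0e.
    by apply/eqP; rewrite eq_le; have := f_le n y; rewrite fy0 lee_fin => ->/=.
  apply: cvgeM; [|exact: f_cvg|exact: cvg_cst].
  by rewrite mule_defE negb_or !negb_and eqe fy0/= orbT.
- move=> n; apply: emeasurable_funM => //; exact/measurable_EFinP/measurable_funP.
- by move=> n y _; rewrite mule_ge0// lee_fin.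
- move=> y _ i n mn; rewrite lee_wpmul2r// lee_fin; exact/lefP/nd_nnsfun_approx.
Qed.

End density.

(** * The inverse time and its truncations *)

Section truncations.
Context (R : realType).
Notation T := (ebar_nneg R).

Definition tinv (t : T) : \bar R := ((ebarval t)^-1)%E.
(** The value at 0 is the default 0 instead of +oo; a measure whose inverse moment
    is finite does not charge 0, see [ae_rec]. *)
Definition trec (t : T) : R := fine (tinv t).

(** The function min (1/t, a). In the coordinate k = t / (1 + t) it is a quotient
    of continuous functions whose denominator stays away from 0, as
    1/t = (1 - k) / k. *)
Definition invmin (a : R) (t : T) : R :=
  let k := Num.max (kap t) (1 + a)^-1 in (1 - k) / k.

(** The function min (t, b), from t = k / (1 - k) in the coordinate k. *)
Definition tmin (b : R) (t : T) : R :=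
  let k := Num.min (kap t) (b / (1 + b)) in k / (1 - k).

Lemma T_cases (t : T) : ebarval t = +oo%E \/ exists2 r : R, 0 <= r & ebarval t = r%:E.
Proof.
have := ebarval_ge0 t; case: (ebarval t) => [r||//]; last by left.
by rewrite lee_fin => r0; right; exists r.
Qed.

Lemma kap_fin (t : T) (r : R) : 0 <= r -> ebarval t = r%:E -> kap t = r / (1 + r).
Proof. by move=> r0; rewrite /kap => -> /=; rewrite ger0_norm. Qed.

Lemma kap_y (t : T) : ebarval t = +oo%E -> kap t = 1.
Proof. by rewrite /kap => ->. Qed.

Lemma invmin_fin a t r : 0 < a -> 0 < r -> ebarval t = r%:E ->
  invmin a t = Num.min r^-1 a.
Proof.
move=> a0 r0 tr; rewrite /invmin (kap_fin (ltW r0) tr).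
have r1 : 0 < 1 + r by rewrite addr_gt0.
have a1 : 0 < 1 + a by rewrite addr_gt0.
have E : (r / (1 + r) <= (1 + a)^-1) = (a <= r^-1).
  rewrite ler_pdivrMr// mulrC ler_pdivlMr// mulrDr mulr1.
  by rewrite addrC lerD2r -[r^-1]mul1r ler_pdivlMr// mulrC.
have [|] := leP (r / (1 + r)) (1 + a)^-1; rewrite ?E => h.
  rewrite min_r//; field.
  by rewrite gt_eqF.
rewrite min_l; last by move: h; rewrite ltNge E -ltNge => /ltW.
by field; rewrite !gt_eqF.
Qed.

Lemma invmin_y a t : 0 < a -> ebarval t = +oo%E -> invmin a t = 0.
Proof.
move=> a0 ty; rewrite /invmin (kap_y ty) max_l ?subrr ?mul0r//.
by rewrite invf_le1 ?addr_gt0// lerDl ltW.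
Qed.

Lemma invmin_0 a t : 0 < a -> ebarval t = 0%E -> invmin a t = a.
Proof.
move=> a0 t0; rewrite /invmin (kap_fin (lexx 0) t0) mul0r max_r.
  by field; rewrite gt_eqF// addr_gt0.
by rewrite invr_ge0 addr_ge0// ltW.
Qed.

Lemma tmin_fin b t r : 0 < b -> 0 <= r -> ebarval t = r%:E ->
  tmin b t = Num.min r b.
Proof.
move=> b0 r0 tr; rewrite /tmin (kap_fin r0 tr).
have r1 : 0 < 1 + r by rewrite ltr_pwDl.
have b1 : 0 < 1 + b by rewrite addr_gt0.
have E : (r / (1 + r) <= b / (1 + b)) = (r <= b).
  by rewrite ler_pdivrMr// mulrAC ler_pdivlMr// !mulrDr !mulr1 [r * b]mulrC lerD2r.
have [|] := leP (r / (1 + r)) (b / (1 + b)); rewrite ?E => h.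
  by rewrite min_l//; field; rewrite gt_eqF//= addrK oner_eq0.
rewrite min_r; last by move: h; rewrite ltNge E -ltNge => /ltW.
by field; rewrite gt_eqF//= addrK oner_eq0.
Qed.

Lemma tmin_y b t : 0 < b -> ebarval t = +oo%E -> tmin b t = b.
Proof.
move=> b0 ty; have b1 : 0 < 1 + b by rewrite addr_gt0.
rewrite /tmin (kap_y ty) min_r.
  by field; rewrite gt_eqF//= addrK oner_eq0.
by rewrite ler_pdivrMr// mul1r lerDr.
Qed.

Lemma continuous_invmin a : 0 < a -> continuous (invmin a).
Proof.
move=> a0 t; have a1 : 0 < (1 + a)^-1 by rewrite invr_gt0 addr_gt0.
have ck : {for t, continuous (fun t => Num.max (kap t) (1 + a)^-1)}.
  apply: (@continuous_max R _ (@kap R) (cst (1 + a)^-1)); first exact: continuous_kap.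
  exact: cst_continuous.
apply: (@continuousM _ _ (fun t => 1 - Num.max (kap t) (1 + a)^-1)
    (fun t => (Num.max (kap t) (1 + a)^-1)^-1)).
  by apply: continuousB; [exact: cst_continuous|exact: ck].
by apply: continuousV; [rewrite gt_eqF// lt_max a1 orbT|exact: ck].
Qed.

Lemma continuous_tmin b : 0 < b -> continuous (tmin b).
Proof.
move=> b0 t.
have ck : {for t, continuous (fun t => Num.min (kap t) (b / (1 + b)))}.
  apply: (@continuous_min R _ (@kap R) (cst (b / (1 + b)))); first exact: continuous_kap.
  exact: cst_continuous.
apply: (@continuousM _ _ (fun t => Num.min (kap t) (b / (1 + b)))
    (fun t => (1 - Num.min (kap t) (b / (1 + b)))^-1)); first exact: ck.
apply: continuousV; last by apply: continuousB; [exact: cst_continuous|exact: ck].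
rewrite subr_eq0 eq_sym lt_eqF// gt_min; apply/orP; right.
by rewrite ltr_pdivrMr ?addr_gt0// mul1r ltrDr.
Qed.

Lemma invmin_ge0 a t : 0 < a -> 0 <= invmin a t.
Proof.
move=> a0; case: (T_cases t) => [ty|[r r0 tr]]; first by rewrite invmin_y.
move: r0; rewrite le_eqVlt => /predU1P[r0|r0].
  by rewrite invmin_0 ?ltW// tr -r0.
by rewrite (invmin_fin a0 r0 tr) le_min invr_ge0 !ltW.
Qed.

Lemma invmin_le a t : 0 < a -> invmin a t <= a.
Proof.
move=> a0; case: (T_cases t) => [ty|[r r0 tr]]; first by rewrite invmin_y// ltW.
move: r0; rewrite le_eqVlt => /predU1P[r0|r0].
  by rewrite invmin_0// tr -r0.
by rewrite (invmin_fin a0 r0 tr) ge_min lexx orbT.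
Qed.

Lemma tmin_ge0 b t : 0 < b -> 0 <= tmin b t.
Proof.
move=> b0; case: (T_cases t) => [ty|[r r0 tr]]; first by rewrite tmin_y// ltW.
by rewrite (tmin_fin b0 r0 tr) le_min r0 ltW.
Qed.

Lemma tmin_le b t : 0 < b -> tmin b t <= b.
Proof.
move=> b0; case: (T_cases t) => [ty|[r r0 tr]]; first by rewrite tmin_y.
by rewrite (tmin_fin b0 r0 tr) ge_min lexx orbT.
Qed.

Lemma rec_fin t r : 0 < r -> ebarval t = r%:E -> trec t = r^-1.
Proof. by move=> r0; rewrite /trec /tinv => ->; rewrite inver gt_eqF. Qed.

Lemma rec_y t : ebarval t = +oo%E -> trec t = 0.
Proof. by rewrite /trec /tinv => ->; rewrite invey. Qed.

Lemma rec_0 t : ebarval t = 0%E -> trec t = 0.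
Proof. by rewrite /trec /tinv => ->; rewrite inve0. Qed.

Lemma rec_ge0 t : 0 <= trec t.
Proof. by rewrite fine_ge0// inve_ge0 ebarval_ge0. Qed.

Lemma inv_ge0 t : (0 <= tinv t)%E.
Proof. by rewrite inve_ge0 ebarval_ge0. Qed.

(** Both sides are (1/t - a)^+. The weight on the left is the bounded continuous
    function (1 - a t)^+: the part of 1/t above the level a is reached by an
    admissible test function. *)
Lemma rec_tail a t : 0 < a -> ebarval t != 0%E ->
  (1 - a * tmin a^-1 t) * trec t = trec t - invmin a t.
Proof.
move=> a0; have ia0 : 0 < a^-1 by rewrite invr_gt0.
case: (T_cases t) => [ty|[r r0 tr]] t0.
  by rewrite rec_y// invmin_y// mulr0 subrr.
have {}r0 : 0 < r by rewrite lt_neqAle eq_sym r0 andbT; move: t0; rewrite tr.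
rewrite (rec_fin r0 tr) (invmin_fin a0 r0 tr) (tmin_fin ia0 (ltW r0) tr).
have [h|h] := leP r a^-1.
  rewrite min_r; last by rewrite -[leLHS]invrK lef_pV2.
  by field; rewrite gt_eqF.
rewrite min_l; last by rewrite ltW// -[ltRHS]invrK ltf_pV2.
by rewrite divff ?gt_eqF// subrr mul0r subrr.
Qed.

Lemma invmin_cvg t : (invmin n.+1%:R t)%:E @[n --> \oo] --> tinv t.
Proof.
case: (T_cases t) => [ty|[r r0 tr]].
  rewrite /tinv ty invey; apply: cvg_near_cst; apply: nearW => n.
  by rewrite invmin_y.
move: r0; rewrite le_eqVlt => /predU1P[r0|r0].
  rewrite /tinv tr -r0 inve0.
  under eq_fun do rewrite invmin_0 ?tr -?r0//.
  by apply/cvgeryP; rewrite cvg_shiftS; exact: cvgr_idn.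
rewrite /tinv tr inver gt_eqF//; apply: cvg_near_cst.
near=> n; rewrite (@invmin_fin _ t r)// min_l//.
rewrite (@le_trans _ _ n%:R)// ?ler_nat//.
near: n; exact: nbhs_infty_ger.
Unshelve. all: by end_near. Qed.

Lemma invmin_nd t : {homo (fun n : nat => invmin n.+1%:R t) : n m / (n <= m)%N >-> n <= m}.
Proof.
move=> n m nm.
have nm1 : n.+1%:R <= m.+1%:R :> R by rewrite ler_nat.
case: (T_cases t) => [ty|[r r0 tr]]; first by rewrite !invmin_y.
move: r0; rewrite le_eqVlt => /predU1P[r0|r0].
  by rewrite !invmin_0// tr -r0.
by rewrite !(@invmin_fin _ t r)// le_min !ge_min lexx nm1 orbT.
Qed.

Lemma measurable_inv : measurable_fun setT tinv.
Proof.
apply: (emeasurable_fun_cvg (fun n t => (invmin n.+1%:R t)%:E)).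
  move=> n; apply/measurable_EFinP; apply: continuous_measurable_T.
  exact: continuous_invmin.
by move=> t _; exact: invmin_cvg.
Qed.

Lemma measurable_rec : measurable_fun setT trec.
Proof. by apply: measurableT_comp => //; exact: measurable_inv. Qed.

End truncations.

(** * Measures with a finite inverse moment *)

Section inverse_moment.
Context (R : realType).
Notation T := (ebar_nneg R).
Variable nu : {finite_measure set T -> \bar R}.

Lemma measurable_preT (A : set (\bar R)) : measurable A ->
  measurable [set t : T | A (ebarval t)].
Proof. by move=> mA; rewrite -[X in measurable X]setTI; exact: measurable_ebarval. Qed.

Lemma measurable_point (c : \bar R) : measurable [set t : T | ebarval t = c].
Proof. exact: (@measurable_preT [set c] (emeasurable_set1 c)). Qed.

Lemma Cb_integrable (f : T -> R) : Cb f -> nu.-integrable setT (EFin \o f).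
Proof.
move=> [cf bf]; apply: bounded_integrable => //.
  exact: fin_num_measure.
exact: continuous_measurable_T.
Qed.

Lemma Cb_invmin (a : R) : 0 < a -> Cb (invmin a : T -> R).
Proof.
move=> a0; split; first exact: continuous_invmin.
by apply: (@bounded_fun_intro _ _ _ a) => t; rewrite ger0_norm ?invmin_ge0// invmin_le.
Qed.

Lemma Cb_tmin (b : R) : 0 < b -> Cb (tmin b : T -> R).
Proof.
move=> b0; split; first exact: continuous_tmin.
by apply: (@bounded_fun_intro _ _ _ b) => t; rewrite ger0_norm ?tmin_ge0// tmin_le.
Qed.

Lemma Cb_cst (c : R) : Cb (cst c : T -> R).
Proof.
split; first by move=> t; exact: cst_continuous.
by apply: (@bounded_fun_intro _ _ _ `|c|).
Qed.

Lemma CbD (f g : T -> R) : Cb f -> Cb g -> Cb (f \+ g).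
Proof.
move=> [cf /bounded_fun_ex[A A0 fA]] [cg /bounded_fun_ex[B B0 gB]]; split.
  by move=> t; apply: continuousD; [exact: cf|exact: cg].
apply: (@bounded_fun_intro _ _ _ (A + B)) => t.
by rewrite (le_trans (ler_normD _ _))// lerD.
Qed.

Lemma CbM (f g : T -> R) : Cb f -> Cb g -> Cb (f \* g).
Proof.
move=> [cf /bounded_fun_ex[A A0 fA]] [cg /bounded_fun_ex[B B0 gB]]; split.
  by move=> t; apply: continuousM; [exact: cf|exact: cg].
apply: (@bounded_fun_intro _ _ _ (A * B)) => t.
by rewrite normrM ler_pM.
Qed.

(** Monotone convergence of the truncations of 1/t. *)
Lemma inverse_moment_from_truncations (Z : R) :
  (forall n : nat, \int[nu]_t invmin n.+1%:R t <= Z) ->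
  (forall e, 0 < e -> exists n : nat, Z - e <= \int[nu]_t invmin n.+1%:R t) ->
  (\int[nu]_t tinv t = Z%:E)%E.
Proof.
move=> leZ geZ.
have cv : (\int[nu]_t (invmin n.+1%:R t)%:E)%E @[n --> \oo] --> (\int[nu]_t tinv t)%E.
  rewrite (_ : (\int[nu]_t tinv t)%E =
      (\int[nu]_t limn (fun n => (invmin n.+1%:R t)%:E))%E); last first.
    by apply: eq_integral => t _; apply/esym/cvg_lim => //; exact: invmin_cvg.
  apply: cvg_monotone_convergence => //.
  - move=> n; apply/measurable_EFinP; apply: continuous_measurable_T.
    exact: continuous_invmin.
  - by move=> n t _; rewrite lee_fin invmin_ge0.
  - by move=> t _ n m nm; rewrite lee_fin invmin_nd.
have nE n : (\int[nu]_t (invmin n.+1%:R t)%:E)%E = (\int[nu]_t invmin n.+1%:R t)%:E.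
  by rewrite fineK//; apply: integrable_fin_num => //; apply: Cb_integrable; exact: Cb_invmin.
suff : (\int[nu]_t (invmin n.+1%:R t)%:E)%E @[n --> \oo] --> Z%:E.
  by apply: cvg_unique.
under eq_fun do rewrite nE.
apply: cvg_EFin; first exact: nearW.
apply/cvgrPdist_le => e e0; have [n hn] := geZ e e0.
near=> m; rewrite /= ger0_norm ?subr_ge0// lerBlDl -lerBlDr.
apply: (le_trans hn); apply: le_Rintegral => //.
- by apply: Cb_integrable; exact: Cb_invmin.
- by apply: Cb_integrable; exact: Cb_invmin.
- move=> t _; apply: (invmin_nd t); near: m; exact: nbhs_infty_ge.
Unshelve. all: by end_near. Qed.

Section given_inverse_moment.
Variable (Z : R).
Hypothesis HZ : (\int[nu]_t tinv t = Z%:E)%E.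

Let ginv : nu.-integrable setT (@tinv R).
Proof.
apply/integrableP; split; first exact: measurable_inv.
under eq_integral do rewrite gee0_abs ?inv_ge0//.
by rewrite HZ ltry.
Qed.

Lemma null_at_0 : nu [set t | ebarval t = 0%E] = 0%E.
Proof.
have mN : measurable [set t : T | ebarval t = 0%E].
  exact: measurable_point.
apply: measure_negligible => //.
apply: negligibleS (integrable_ae measurableT ginv) => t /= t0 /(_ I).
by rewrite /tinv t0 inve0.
Qed.

Lemma ae_rec : {ae nu, forall t, (trec t)%:E = tinv t}.
Proof.
exists [set t | ebarval t = 0%E]; split.
- exact: measurable_point.
- exact: null_at_0.
move=> t /=; apply: contra_notP => t0; case: (T_cases t) => [ty|[r r0 tr]].
  by rewrite rec_y// /tinv ty invey.
have {}r0 : 0 < r by rewrite lt_neqAle r0 andbT; apply/eqP => r0'; apply: t0; rewrite tr -r0'.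
by rewrite (rec_fin r0 tr) /tinv tr inver gt_eqF.
Qed.

Lemma integral_recE : (\int[nu]_t (trec t)%:E = Z%:E)%E.
Proof.
rewrite -HZ; apply: ae_eq_integral => //.
- by apply/measurable_EFinP; exact: measurable_rec.
- exact: measurable_inv.
- by apply: filterS ae_rec => t h _.
Qed.

Lemma integrable_rec : nu.-integrable setT (EFin \o @trec R).
Proof.
apply/integrableP; split; first by apply/measurable_EFinP; exact: measurable_rec.
under eq_integral do rewrite /= ger0_norm ?rec_ge0//.
by rewrite integral_recE ltry.
Qed.

Lemma Rintegral_rec : \int[nu]_t trec t = Z.
Proof. by rewrite /Rintegral integral_recE. Qed.

Lemma moment_ge0 : 0 <= Z.
Proof. by rewrite -Rintegral_rec; apply: Rintegral_ge0 => t _; exact: rec_ge0. Qed.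

Lemma integrable_mul_rec (f : T -> R) : measurable_fun setT f -> bounded_fun f ->
  nu.-integrable setT (EFin \o (fun t => f t * trec t)).
Proof.
move=> mf bf.
have := @integrableMr _ _ _ nu setT measurableT f (EFin \o @trec R) mf bf integrable_rec.
by apply: eq_integrable => // t _ /=; rewrite EFinM.
Qed.

Lemma ae_tail (f : T -> R) (a : R) : 0 < a ->
  {ae nu, forall t, f t * (1 - a * tmin a^-1 t) * trec t = f t * (trec t - invmin a t)}.
Proof.
move=> a0; exists [set t | ebarval t = 0%E]; split.
- exact: measurable_point.
- exact: null_at_0.
- move=> t /=; apply: contra_notP => /eqP t0.
  by rewrite -mulrA rec_tail.
Qed.

Lemma tail_test (K a : R) : 0 < a ->
  \int[nu]_t ((K * (1 - a * tmin a^-1 t)) * trec t) =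
  K * (Z - \int[nu]_t invmin a t).
Proof.
move=> a0; have ia0 : 0 < a^-1 by rewrite invr_gt0.
have iw := Cb_integrable (Cb_invmin a0).
have iB : nu.-integrable setT (EFin \o (fun t => trec t - invmin a t)).
  have := integrableB measurableT integrable_rec iw.
  by apply: eq_integrable => // t _ /=; rewrite EFinB.
rewrite -Rintegral_rec -RintegralB//; last exact: integrable_rec.
rewrite -RintegralZl//; congr fine; apply: ae_eq_integral => //.
- apply/measurable_EFinP; apply: measurable_funM; last exact: measurable_rec.
  apply: measurable_funM => //; apply: measurable_funB => //.
  by apply: measurable_funM => //; apply: continuous_measurable_T; exact: continuous_tmin.
- apply/measurable_EFinP; apply: measurable_funM => //.
  by have /measurable_EFinP := measurable_int _ iB.
- by apply: filterS (ae_tail (cst K) a0) => t h _; congr (_ %:E).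
Qed.

(** The integrands differ by f times the part of 1/t above the level a. *)
Lemma tail_bound (f : T -> R) (H a : R) : 0 < a -> measurable_fun setT f ->
  (forall t, `|f t| <= H) ->
  `|\int[nu]_t (f t * trec t) - \int[nu]_t (f t * invmin a t)| <=
  H * (Z - \int[nu]_t invmin a t).
Proof.
move=> a0 mf fH; have ia0 : 0 < a^-1 by rewrite invr_gt0.
have bf : bounded_fun f by exact: (bounded_fun_intro fH).
have iw := Cb_integrable (Cb_invmin a0).
have i1 := integrable_mul_rec mf bf.
have [H0 H00 wH] := bounded_fun_ex (Cb_invmin a0).2.
have i2 : nu.-integrable setT (EFin \o (fun t => f t * invmin a t)).
  apply: bounded_integrable; first exact: fin_num_measure.
    apply: measurable_funM => //; apply: continuous_measurable_T.
    exact: continuous_invmin.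
  apply: (@bounded_fun_intro _ _ _ (H * H0)) => t.
  by rewrite normrM ler_pM.
have iB : nu.-integrable setT (EFin \o (fun t => f t * trec t - f t * invmin a t)).
  have := integrableB measurableT i1 i2.
  by apply: eq_integrable => // t _ /=; rewrite EFinB.
have g0 t : 0 <= H * (1 - a * tmin a^-1 t) * trec t.
  apply: mulr_ge0; last exact: rec_ge0.
  apply: mulr_ge0; first exact: le_trans (fH t).
  by rewrite subr_ge0 mulrC -ler_pdivlMr// mul1r; exact: tmin_le.
have iG : nu.-integrable setT (EFin \o (fun t => H * (1 - a * tmin a^-1 t) * trec t)).
  have [ct /bounded_fun_ex[H1 H10 tH1]] := Cb_tmin ia0.
  apply: integrable_mul_rec.
    apply: measurable_funM => //; apply: measurable_funB => //.
    by apply: measurable_funM => //; exact: continuous_measurable_T.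
  apply: (@bounded_fun_intro _ _ _ (`|H| * (1 + a * H1))) => t.
  rewrite normrM ler_wpM2l// (le_trans (ler_normB _ _))// normr1 lerD2l.
  by rewrite normrM (ger0_norm (ltW a0)); apply: ler_wpM2l => //; exact: ltW.
rewrite -RintegralB//; apply: (le_trans (le_normr_Rintegral _ _)) => //.
rewrite -(tail_test H a0) -lee_fin !fineK; last 2 first.
- exact: integrable_fin_num.
- by apply: integrable_fin_num => //; exact: integrable_norm.
apply: ae_ge0_le_integral => //.
- apply/measurable_EFinP; apply: measurableT_comp => //.
  by have /measurable_EFinP := measurable_int _ iB.
- by move=> t _; rewrite lee_fin; exact: g0.
- exact: (measurable_int _ iG).
- have g1 t : 0 <= 1 - a * tmin a^-1 t.
    by rewrite subr_ge0 mulrC -ler_pdivlMr// mul1r; exact: tmin_le.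
  apply: filterS (ae_tail (cst 1) a0) => t.
  rewrite /cst !mul1r => h _; rewrite lee_fin -mulrBr -h normrM -mulrA.
  rewrite [X in _ * X]ger0_norm; last by apply: mulr_ge0 => //; exact: rec_ge0.
  by apply: ler_wpM2r => //; apply: mulr_ge0 => //; exact: rec_ge0.
Qed.

End given_inverse_moment.
End inverse_moment.

(** * The variational formula of the entropy *)

Section entropies.
Context (R : realType).

Section generic.
Context d (U : topMeasurableType d).
Variables (n1 n2 : {measure set U -> \bar R}).
Hypotheses (n1fin : n1 setT \is a fin_num) (n2fin : n2 setT \is a fin_num).
(* holds as soon as the sigma-algebra contains the Borel sets *)
Hypothesis CbmU : forall f : U -> R, Cb f -> measurable_fun setT f.

Lemma Cb_fin_integral (n : {measure set U -> \bar R}) (f : U -> R) :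
  n setT \is a fin_num -> measurable_fun setT f ->
  bounded_fun f -> (\int[n]_t (f t)%:E)%E = (\int[n]_t f t)%:E.
Proof.
move=> nfin mf bf; rewrite fineK//; apply: integrable_fin_num => //.
exact: bounded_integrable.
Qed.

Lemma bounded_expR (V : Type) (f : V -> R) : bounded_fun f -> bounded_fun (fun t => expR (f t)).
Proof.
move=> /bounded_fun_ex[H H0 fH]; apply: (@bounded_fun_intro _ _ _ (expR H)) => t.
by rewrite ger0_norm ?expR_ge0// ler_expR (le_trans (ler_norm _)).
Qed.

Lemma exp_moment_gt0 (f : U -> R) : (0 < n2 setT)%E -> measurable_fun setT f ->
  bounded_fun f -> 0 < \int[n2]_t expR (f t).
Proof.
move=> n20 mf bf; have [H H0 fH] := bounded_fun_ex bf.
have me : measurable_fun setT (fun t => expR (f t)) by exact: measurableT_comp.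
apply: (@lt_le_trans _ _ (\int[n2]_t (cst (expR (- H)) t))).
  rewrite Rintegral_cst// mulr_gt0 ?expR_gt0// fine_gt0// n20 ltey_eq.
  by rewrite n2fin.
apply: le_Rintegral => //.
- apply: bounded_integrable => //.
  by apply: (@bounded_fun_intro _ _ _ `|expR (- H)|).
- apply: bounded_integrable => //.
  exact: bounded_expR.
- move=> t _; rewrite ler_expR lerNl; have := fH t.
  by rewrite ler_norml lerNl => /andP[].
Qed.

(** For finite measures and bounded tests both integrals are finite, so that the
    extended supremum is one of real numbers. *)
Lemma entropyE : (0 < n2 setT)%E ->
  entropy n1 n2 = ereal_sup [set (\int[n1]_t phi t - ln (\int[n2]_t expR (phi t)))%:E | phi in @Cb _ U R].
Proof.
move=> n20.
have key phi : Cb phi ->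
    (\int[n1]_t (phi t)%:E - lne (\int[n2]_t (expR (phi t))%:E))%E =
    (\int[n1]_t phi t - ln (\int[n2]_t expR (phi t)))%:E.
  move=> [cphi bphi]; have mphi : measurable_fun setT phi by exact: CbmU.
  have mexp : measurable_fun setT (fun t => expR (phi t)) by exact: measurableT_comp.
  rewrite (Cb_fin_integral n1fin mphi bphi) (Cb_fin_integral n2fin mexp (bounded_expR bphi)).
  by rewrite lne_EFin ?EFinB//; exact: exp_moment_gt0.
congr ereal_sup; apply/seteqP; split => _ [phi phiC <-]; exists phi => //.
  by rewrite key.
by rewrite key.
Qed.

End generic.

Section finite_space.
Variable E : finPointedType.
Notation D := (discrete_topology E).

Lemma measurable_discrete (f : D -> R) : measurable_fun setT f.
Proof. by []. Qed.

Lemma bounded_fun_fin (f : E -> R) : bounded_fun f.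
Proof.
apply: (@bounded_fun_intro _ _ _ (\sum_(y : E) `|f y|)) => y.
by rewrite (bigD1 y)//= lerDl sumr_ge0.
Qed.

Lemma Cb_discrete (f : D -> R) : Cb f.
Proof.
split; last exact: bounded_fun_fin.
move=> x A /= nA; apply: (@open_nbhs_nbhs D x (f @^-1` A)).
by split; [exact: discrete_open|exact: nbhs_singleton nA].
Qed.

(** The set function [weights] is a finite sum of scaled Dirac masses. *)
Lemma weightsE (w : E -> R) (w0 : forall y, 0 <= w y) :
  exists2 n : {measure set D -> \bar R}, weights w = n :> (set D -> \bar R) &
  forall f : D -> R, \int[n]_y f y = \sum_(y : E) w y * f y.
Proof.
pose e := nth (point : E) (enum E).
pose n : {measure set D -> \bar R} :=
  msum (fun k => mscale (NngNum (w0 (e k))) (\d_(e k : D))) #|E|.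
have nE : weights w = n.
  apply/funext => A; rewrite /weights big_mkcond -sum_nth_enum.
  apply: eq_bigr => k _.
  change ((if e k \in A then (w (e k))%:E else 0%E) = ((w (e k))%:E * (\1_A (e k))%:E)%E).
  rewrite indicE.
  by case: (e k \in A); rewrite ?mule1 ?mule0.
exists n => // f.
have nT : n setT = (\sum_(y : E) w y)%:E.
  by rewrite -nE /weights -sumEFin; apply: eq_bigl => y; rewrite in_setT.
have [H H0 fH] := bounded_fun_ex (bounded_fun_fin f).
have fH1 y : 0 <= f y + H.
  by rewrite -lerBlDr sub0r; have := fH y; rewrite ler_norml => /andP[].
have fH1E (y : D) : True -> (0 <= (f y + H)%:E)%E by move=> _; rewrite lee_fin; exact: fH1.
have mEf : measurable_fun setT (fun y : D => (f y + H)%:E) by [].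
rewrite (Rintegral_shift (H := H)) ?nT//.
rewrite ge0_integral_measure_sum//.
rewrite (eq_bigr (fun k : 'I_#|E| => (w (e k) * (f (e k) + H))%:E)); last first.
  move=> k _; rewrite ge0_integral_mscale//=.
  by rewrite integral_dirac// diracE in_setT mul1e EFinM.
rewrite sumEFin (sum_nth_enum (fun y => w y * (f y + H))) /=.
rewrite mulr_sumr -sumrB; apply: eq_bigr => y _.
by rewrite mulrDr [H * _]mulrC addrK.
Qed.

End finite_space.

End entropies.

(** * The entropy of the jump law *)

Section scaled_entropy.
Context (R : realType) d (U : topMeasurableType d).
Variables (n1 n2 : {measure set U -> \bar R}).
Hypotheses (n1fin : n1 setT \is a fin_num) (n2T : n2 setT = 1%E).
Hypothesis CbmU : forall f : U -> R, Cb f -> measurable_fun setT f.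

Let n2fin : n2 setT \is a fin_num. Proof. by rewrite n2T. Qed.
Let n20 : (0 < n2 setT)%E. Proof. by rewrite n2T. Qed.

Lemma entropy_ge (phi : U -> R) : Cb phi ->
  ((\int[n1]_t phi t - ln (\int[n2]_t expR (phi t)))%:E <= entropy n1 n2)%E.
Proof.
by move=> phiC; rewrite entropyE//; apply: ereal_sup_ubound; exists phi.
Qed.

Lemma entropy_ge0 : (0 <= entropy n1 n2)%E.
Proof.
have C0 : Cb (cst 0 : U -> R).
  split; first by move=> t; exact: cst_continuous.
  by apply: (@bounded_fun_intro _ _ _ 0) => t; rewrite normr0.
apply: le_trans (entropy_ge C0).
under [X in ln X]eq_Rintegral do rewrite expR0.
by rewrite !Rintegral_cst// n2T /= mul0r mulr1 ln1 subrr.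
Qed.

(** The factor Z makes the test linear in the unnormalised measure and in Z, hence
    stable under limits in which the normalisation may degenerate. *)
Lemma entropy_test (Z : R) (phi : U -> R) : 0 <= Z -> Cb phi ->
  ((Z * \int[n1]_t phi t - Z * ln (\int[n2]_t expR (phi t)))%:E <=
   entropy n1 n2 * Z%:E)%E.
Proof.
move=> Z0 phiC; rewrite -mulrBr EFinM muleC lee_wpmul2r ?lee_fin//.
exact: entropy_ge.
Qed.

Lemma entropy_approx (Z s : R) : 0 < Z -> (s%:E < entropy n1 n2 * Z%:E)%E ->
  exists2 phi : U -> R, Cb phi &
    s < Z * \int[n1]_t phi t - Z * ln (\int[n2]_t expR (phi t)).
Proof.
move=> Z0; rewrite -lte_pdivrMr// entropyE// => /ereal_sup_gt[_ [phi phiC <-]].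
by rewrite lte_fin ltr_pdivrMr// mulrC mulrBr => sphi; exists phi.
Qed.

End scaled_entropy.

Section rate_entropies.
Context (R : realType) (E : finPointedType).
Notation T := (ebar_nneg R).
Notation X := (discrete_topology E * ebar_nneg R)%type.
Variables (p : E -> E -> R) (psi : E -> probability T R).
Hypothesis p_markov : markov_kernel p.
Variables (mu : probability X R) (Q : E -> E -> R).
Hypotheses (Q0 : forall x y, 0 <= Q x y).
Variable (x : E).
Let Z := \sum_(y : E) Q x y.

Lemma flux_eq0 : [forall z, Q x z == 0] = (Z == 0).
Proof.
apply/forallP/idP => [h|].
  by rewrite /Z big1// => y _; exact/eqP.
by rewrite /Z psumr_eq0// => /allP h y; apply: h; rewrite mem_index_enum.
Qed.

Lemma flux_ge0 : 0 <= Z.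
Proof. exact: sumr_ge0. Qed.

Lemma pQ_ge0 y : 0 <= pQ p Q x y.
Proof. by rewrite /pQ; case: ifP => _; [exact: p_markov.1|apply: divr_ge0 => //; exact: flux_ge0]. Qed.

(** The variational functional of the jump law times Z, which is linear in Q. *)
Definition jump_test (f : E -> R) : R :=
  \sum_(y : E) Q x y * f y - Z * ln (\sum_(y : E) p x y * expR (f y)).

(** If no flux leaves x, then the conventional jump law is multiplied by Z = 0,
    and the last identity still holds. *)
Lemma jump_entropy_measures : exists n1 n2 : {measure set (discrete_topology E) -> \bar R},
  [/\ weights (pQ p Q x) = n1 :> (set _ -> \bar R), weights (p x) = n2 :> (set _ -> \bar R),
   n1 setT \is a fin_num, n2 setT = 1%E & forall f : discrete_topology E -> R,
   \int[n2]_y f y = \sum_(y : E) p x y * f y /\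
   Z * \int[n1]_y f y = \sum_(y : E) Q x y * f y].
Proof.
have [n1 n1E n1f] := weightsE pQ_ge0.
have [n2 n2E n2f] := weightsE (p_markov.1 x).
exists n1, n2; split => //.
- by rewrite -n1E /weights sum_fin_num; apply/allP => _ /mapP[y _ ->].
- rewrite -n2E /weights sumEFin; congr (_ %:E); rewrite -[RHS](p_markov.2 x).
  by apply: eq_bigl => y; rewrite in_setT.
move=> f; split => //; rewrite n1f mulr_sumr; apply: eq_bigr => y _.
rewrite mulrA; congr (_ * _); rewrite /pQ flux_eq0 -/Z; case: eqVneq => Z0.
  rewrite Z0 mul0r; have : [forall z, Q x z == 0] by rewrite flux_eq0 Z0.
  by move/forallP/(_ y)/eqP.
by rewrite mulrCA divff ?mulr1.
Qed.

Lemma jump_entropy_ge0 : (0 <= entropy (weights (pQ p Q x)) (weights (p x)))%E.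
Proof.
have [n1 [n2 [-> -> n1fin n2T _]]] := jump_entropy_measures.
by apply: entropy_ge0.
Qed.

Lemma jump_entropy_test (f : E -> R) :
  ((jump_test f)%:E <= entropy (weights (pQ p Q x)) (weights (p x)) * Z%:E)%E.
Proof.
have [n1 [n2 [-> -> n1fin n2T nE]]] := jump_entropy_measures.
have := @entropy_test R _ _ n1 n2 n1fin n2T (fun f _ => measurable_discrete f) Z f flux_ge0 (Cb_discrete f).
by rewrite (nE f).2 (nE (fun y => expR (f y))).1.
Qed.

Lemma jump_entropy_approx (s : R) :
  (s%:E < entropy (weights (pQ p Q x)) (weights (p x)) * Z%:E)%E ->
  exists f : E -> R, s < jump_test f.
Proof.
have [n1 [n2 [-> -> n1fin n2T nE]]] := jump_entropy_measures.
have := flux_ge0; rewrite le_eqVlt => /predU1P[Z0|Z0].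
  rewrite -Z0 mule0 lte_fin => s0; exists (cst 0); rewrite /jump_test -Z0 mul0r subr0.
  by rewrite big1// => y _; rewrite mulr0.
move=> /(@entropy_approx R _ _ n1 n2 n1fin n2T (fun f _ => measurable_discrete f) Z s Z0) [f _].
by rewrite (nE f).2 (nE (fun y => expR (f y))).1; exists f.
Qed.

End rate_entropies.

(** * The entropy of the law of the holding time *)

Section hold.
Context (R : realType) (E : finPointedType).
Notation T := (ebar_nneg R).
Notation X := (discrete_topology E * ebar_nneg R)%type.

Lemma Cb_measurable_T (f : T -> R) : Cb f -> measurable_fun setT f.
Proof. by move=> [cf _]; exact: continuous_measurable_T. Qed.

(** The shift by H makes f nonnegative; it contributes H times the mass Z of the
    tilted measure, which is subtracted again. *)
Lemma Rintegral_tilted (nu : {finite_measure set T -> \bar R}) (Z : R) (f : T -> R) :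
  (\int[nu]_t tinv t = Z%:E)%E -> Cb f ->
  \int[dens_measure nu (@measurable_inv R) (@inv_ge0 R)]_t f t =
  \int[nu]_t (f t * trec t).
Proof.
move=> HZ fC; set D := dens_measure _ _ _.
have mf := Cb_measurable_T fC; have [H H0 fH] := bounded_fun_ex fC.2.
have DT : D setT = Z%:E by rewrite -HZ.
have fH0 t : 0 <= f t + H.
  by rewrite -lerBlDr sub0r; have := fH t; rewrite ler_norml => /andP[].
have mfH : measurable_fun setT (fun t => f t + H) by exact: measurable_funD.
have bfH : bounded_fun (fun t => f t + H).
  apply: (@bounded_fun_intro _ _ _ (H + H)) => t.
  by rewrite (le_trans (ler_normD _ _))// lerD// ger0_norm.
have iH := integrable_mul_rec HZ mfH bfH.
rewrite (Rintegral_shift (H := H))// DT//.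
rewrite ge0_integral_dens//.
rewrite (_ : (\int[nu]_u ((f u + H)%:E * tinv u))%E =
   (\int[nu]_u ((f u + H) * trec u)%:E)%E); last first.
  apply: ae_eq_integral => //.
  - apply: emeasurable_funM; [exact/measurable_EFinP|exact: measurable_inv].
  - exact: (measurable_int _ iH).
  - by apply: filterS (ae_rec HZ) => t h _; rewrite EFinM h.
rewrite -/(Rintegral _ _ _) /= -(Rintegral_rec HZ).
rewrite -RintegralZl//; last exact: integrable_rec HZ.
rewrite -RintegralB//; last first.
  have := integrableZl measurableT H (integrable_rec HZ).
  by apply: eq_integrable => // t _ /=; rewrite EFinM.
by apply: eq_Rintegral => t _; rewrite mulrDl addrK.
Qed.

Lemma norm_moment_le (nu : {finite_measure set T -> \bar R}) (Z : R) (f : T -> R) (H : R) :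
  (\int[nu]_t tinv t = Z%:E)%E -> Cb f -> (forall t, `|f t| <= H) ->
  `|\int[nu]_t (f t * trec t)| <= H * Z.
Proof.
move=> HZ fC fH.
have i1 := integrable_mul_rec HZ (Cb_measurable_T fC) fC.2.
apply: (le_trans (le_normr_Rintegral _ _)) => //.
rewrite -(Rintegral_rec HZ) -RintegralZl//; last exact: integrable_rec HZ.
apply: le_Rintegral => //.
- exact: integrable_norm.
- have := integrableZl measurableT H (integrable_rec HZ).
  by apply: eq_integrable => // t _ /=; rewrite EFinM.
- by move=> t _; rewrite normrM (ger0_norm (rec_ge0 t)) ler_wpM2r// rec_ge0.
Qed.

Variables (psi : E -> probability T R).
Variables (mu : probability X R) (Q : E -> E -> R).
Hypotheses (Q0 : forall x y, 0 <= Q x y).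
Variable (x : E).
Let Z := \sum_(y : E) Q x y.
Hypothesis HZ : (\int[slice mu x]_t tinv t = Z%:E)%E.

(** If no flux leaves x, then the inverse moment of the slice is 0, and both sides
    of the last identity vanish. *)
Lemma hold_entropy_measure : exists n1 : {measure set T -> \bar R},
  [/\ psimu psi mu Q x = n1 :> (set _ -> \bar R), n1 setT \is a fin_num &
   forall f : T -> R, Cb f -> Z * \int[n1]_t f t = \int[slice mu x]_t (f t * trec t)].
Proof.
have Z0 : 0 <= Z by exact: flux_ge0.
have [Ze|Zne] := eqVneq Z 0.
  exists (psi x); split; first by apply/funext => A; rewrite /psimu flux_eq0// -/Z Ze eqxx.
    exact: fin_num_measure.
  move=> f fC; rewrite Ze mul0r.
  have [H H0 fH] := bounded_fun_ex fC.2.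
  apply/esym/eqP; rewrite -normr_le0.
  by apply: le_trans (norm_moment_le HZ fC fH) _; rewrite Ze mulr0.
have iZ0 : 0 <= Z^-1 by rewrite invr_ge0.
pose D := dens_measure (slice mu x) (@measurable_inv R) (@inv_ge0 R).
have DT : D setT = Z%:E by rewrite -HZ.
exists (mscale (NngNum iZ0) D); split.
- by apply/funext => A; rewrite /psimu flux_eq0// -/Z (negbTE Zne).
- have h : (Z^-1%:E * D setT)%E \is a fin_num by rewrite DT.
  exact: h.
move=> f fC; have mf := Cb_measurable_T fC.
have Dfin : D setT \is a fin_num by rewrite DT.
rewrite (Rintegral_scale iZ0 Dfin _ mf fC.2)//.
by rewrite (Rintegral_tilted HZ fC) mulrA divff// mul1r.
Qed.

Definition hold_test (f : T -> R) : R :=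
  \int[slice mu x]_t (f t * trec t) - Z * ln (\int[psi x]_t expR (f t)).

Lemma hold_entropy_ge0 : (0 <= entropy (psimu psi mu Q x) (psi x))%E.
Proof.
have [n1 [-> n1fin _]] := hold_entropy_measure.
by apply: entropy_ge0 => //; [exact: probability_setT|exact: Cb_measurable_T].
Qed.

Lemma hold_entropy_test (f : T -> R) : Cb f ->
  ((hold_test f)%:E <= entropy (psimu psi mu Q x) (psi x) * Z%:E)%E.
Proof.
have [n1 [-> n1fin n1E]] := hold_entropy_measure => fC.
have := @entropy_test R _ _ n1 (psi x) n1fin (probability_setT _) Cb_measurable_T Z f (flux_ge0 Q0 x) fC.
by rewrite n1E.
Qed.

Lemma hold_entropy_approx (s : R) :
  (s%:E < entropy (psimu psi mu Q x) (psi x) * Z%:E)%E ->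
  exists2 f : T -> R, Cb f & s < hold_test f.
Proof.
have [n1 [-> n1fin n1E]] := hold_entropy_measure.
have := flux_ge0 Q0 x; rewrite le_eqVlt => /predU1P[Z0|Z0].
  rewrite /Z -Z0 mule0 lte_fin => s0; exists (cst 0); first exact: Cb_cst.
  rewrite /hold_test /Z -Z0 mul0r subr0; under eq_Rintegral do rewrite mul0r.
  by rewrite Rintegral_cst// mul0r.
move=> /(@entropy_approx R _ _ n1 (psi x) n1fin (probability_setT _) Cb_measurable_T Z s Z0) [f fC].
by rewrite n1E//; exists f.
Qed.

(** The only integral of 1/t in the rate is the inverse moment Z, so the integral
    against the slice becomes an expression in Z and in the mass at +oo. *)
Lemma rate_integral (H xi0 : \bar R) : (0 <= H)%E -> (0 <= xi0)%E ->
  (\int[slice mu x]_t (H / ebarval t + xi0 * (\1_[set +oo%E] (ebarval t))%:E) =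
   H * Z%:E + xi0 * slice mu x [set t | ebarval t = +oo])%E.
Proof.
move=> H0 xi00.
have my : measurable_fun setT (fun t : T => (\1_[set +oo%E] (ebarval t))%:E : \bar R).
  apply/measurable_EFinP; rewrite (_ : (fun t => _) = \1_[set t : T | ebarval t = +oo%E]).
    by apply: measurable_indic; exact: measurable_point.
  by apply/funext => t; rewrite !indicE; congr (_%:R); apply/idP/idP; rewrite !inE.
have minv := @measurable_inv R.
rewrite ge0_integralD//; last 4 first.
- by move=> t _; rewrite mule_ge0//; exact: inv_ge0.
- exact: measurable_funeM.
- by move=> t _; rewrite mule_ge0// lee_fin.
- exact: measurable_funeM.
rewrite ge0_integralZl//; last by move=> t _; exact: inv_ge0.
rewrite ge0_integralZl//.
rewrite [X in (H * X)%E](_ : _ = Z%:E)//; congr (_ + _ * _)%E.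
rewrite -[RHS]/(slice mu x _) -[X in slice mu x X]setIT -integral_indic//.
exact: measurable_point.
Qed.

End hold.

(** * Flux bound and uniform integrability at one site *)

Section one_site.
Context (R : realType).
Notation T := (ebar_nneg R).
Variable psi : probability T R.
Hypotheses (psi0 : psi [set t | ebarval t = 0%E] = 0%E)
  (psiy : psi [set t | ebarval t = +oo%E] = 0%E).

(** What remains of an upper bound A on the scaled entropy of the holding time in
    a form that is linear in nu and Z. *)
Definition site_bound (nu : {finite_measure set T -> \bar R}) (Z A : R) :=
  forall f : T -> R, Cb f ->
  \int[nu]_t (f t * trec t) - Z * ln (\int[psi]_t expR (f t)) <= A.

Definition tfin (t : T) : R := fine (ebarval t).
(** The function (t - n)^+. The value at +oo comes from the default of [fine];
    psi does not charge this point. *)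
Definition excess (n : R) (t : T) : R := Num.max (tfin t - n) 0.

Lemma ae_pos_finite : {ae psi, forall t, exists2 r : R, 0 < r & ebarval t = r%:E}.
Proof.
exists ([set t | ebarval t = 0%E] `|` [set t | ebarval t = +oo%E]); split.
- by apply: measurableU; exact: measurable_point.
- apply/eqP; rewrite eq_le measure_ge0 andbT.
  apply: (@le_trans _ _ (psi [set t | ebarval t = 0%E] + psi [set t | ebarval t = +oo%E])%E).
    by apply: measureU2; exact: measurable_point.
  by rewrite psi0 psiy adde0.
- move=> t /=; apply: contra_notP => /not_orP[t0 ty].
  case: (T_cases t) => [//|[r r0 tr]]; exists r => //.
  by rewrite lt_neqAle r0 andbT; apply/eqP => r0'; apply: t0; rewrite tr -r0'.
Qed.

Lemma Rdominated_cvg (f_ : nat -> T -> R) (f g : T -> R) :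
  (forall n, measurable_fun setT (f_ n)) -> measurable_fun setT f ->
  {ae psi, forall t, f_ n t @[n --> \oo] --> f t} ->
  psi.-integrable setT (EFin \o g) -> (forall n t, `|f_ n t| <= g t) ->
  \int[psi]_t f_ n t @[n --> \oo] --> \int[psi]_t f t.
Proof.
move=> mf_ mf fcvg ig fg.
have [] := @dominated_convergence _ _ _ psi setT measurableT
  (fun n t => (f_ n t)%:E) (EFin \o f) (EFin \o g).
- by move=> n; exact/measurable_EFinP.
- exact/measurable_EFinP.
- by apply: filterS fcvg => t h _; exact: cvg_EFin (nearW _ _) h.
- exact: ig.
- by apply: aeW => t n _; rewrite lee_fin.
- move=> iF _ h; apply: fine_cvg; rewrite fineK//.
  exact: integrable_fin_num.
Qed.

(** The function (1 - a t)^+ of [rec_tail]. *)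
Definition cutoff (a : R) (t : T) : R := 1 - a * tmin a^-1 t.

Lemma cutoff_ge0 a t : 0 < a -> 0 <= cutoff a t.
Proof.
by move=> a0; rewrite subr_ge0 mulrC -ler_pdivlMr// mul1r; apply: tmin_le; rewrite invr_gt0.
Qed.

Lemma cutoff_le1 a t : 0 < a -> cutoff a t <= 1.
Proof.
by move=> a0; rewrite gerBl; apply: mulr_ge0; [exact: ltW|apply: tmin_ge0; rewrite invr_gt0].
Qed.

Lemma Cb_cutoff a : 0 < a -> Cb (cutoff a).
Proof.
move=> a0; have ia0 : 0 < a^-1 by rewrite invr_gt0.
split; last first.
  apply: (@bounded_fun_intro _ _ _ 1) => t.
  by rewrite ger0_norm ?cutoff_ge0// cutoff_le1.
move=> t; apply: (@continuousB _ _ _ (cst (1 : R)) (fun t => a * tmin a^-1 t)).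
  exact: cst_continuous.
apply: (@continuousM _ _ (cst a) (tmin a^-1)); first exact: cst_continuous.
exact: continuous_tmin.
Qed.

(** For t > 0 the cutoff vanishes as soon as n + 1 >= 1/t, and psi does not
    charge 0. *)
Lemma exp_cutoff_cvg (K : R) : 0 <= K ->
  \int[psi]_t expR (K * cutoff n.+1%:R t) @[n --> \oo] --> (1 : R).
Proof.
move=> K0.
have c1 : \int[psi]_t (cst (1:R) : T -> R) t = 1.
  by rewrite Rintegral_cst// mul1r; exact: (congr1 fine (probability_setT psi)).
rewrite -[X in _ --> X]c1; apply: (@Rdominated_cvg _ _ (cst (expR K))).
- move=> n; apply: measurableT_comp => //; apply: measurable_funM => //.
  by apply: Cb_measurable_T; exact: Cb_cutoff.
- exact: measurable_cst.
- apply: filterS ae_pos_finite => t [r r0 tr]; apply: cvg_near_cst.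
  near=> n; rewrite /cutoff (tmin_fin _ (ltW r0) tr)// min_r.
    by rewrite divff// subrr mulr0 expR0.
  rewrite -[leRHS]invrK lef_pV2 ?posrE ?invr_gt0//.
  rewrite (@le_trans _ _ n%:R)// ?ler_nat//; near: n; exact: nbhs_infty_ger.
- apply: bounded_integrable => //; first exact: fin_num_measure.
  by apply: (@bounded_fun_intro _ _ _ `|expR K|).
- move=> n t; rewrite ger0_norm ?expR_ge0// ler_expR.
  by rewrite ler_piMr// cutoff_le1.
Unshelve. all: by end_near. Qed.

(** For each factor K some cutoff makes the logarithmic term of the test at most
    half of Z. *)
Lemma exp_cutoff_small (K : R) : 0 <= K ->
  exists n, ln (\int[psi]_t expR (K * cutoff n.+1%:R t)) <= 2^-1.
Proof.
move=> K0; have e1 : 1 < expR (2^-1) :> R by rewrite expR_gt1 invr_gt0.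
have [n _ hn] := cvgr_lt _ (exp_cutoff_cvg K0) _ e1.
exists n; rewrite -[leRHS]expRK ler_ln ?posrE ?expR_gt0//.
  by apply/ltW; apply: hn => /=.
have C1 : Cb (fun t => K * cutoff n.+1%:R t).
  by apply: (CbM (Cb_cst _) (Cb_cutoff _)).
apply: exp_moment_gt0 => //.
- by rewrite fin_num_measure.
- by have := @lte01 R; rewrite -(probability_setT psi).
- exact: Cb_measurable_T.
- exact: C1.2.
Qed.

Lemma cutoff_site_bound (nu : {finite_measure set T -> \bar R}) (Z A K a : R) :
  (\int[nu]_t tinv t = Z%:E)%E -> 0 < a ->
  site_bound nu Z A ->
  K * (Z - \int[nu]_t invmin a t) - Z * ln (\int[psi]_t expR (K * cutoff a t)) <= A.
Proof.
move=> HZ a0 nuA; have := nuA (fun t => K * cutoff a t) (CbM (Cb_cst _) (Cb_cutoff a0)).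
by rewrite (tail_test HZ).
Qed.

(** The cutoff at a = n + 1 as a test: the part of 1/t below a has integral at most
    a, thus Z - a - Z / 2 <= A. *)
Lemma site_flux_bound (A : R) : exists C, forall (nu : {finite_measure set T -> \bar R}) Z,
  (\int[nu]_t tinv t = Z%:E)%E -> (nu setT <= 1)%E -> site_bound nu Z A -> Z <= C.
Proof.
have [n hn] := exp_cutoff_small ler01.
exists (2 * (A + n.+1%:R)) => nu Z HZ nu1 nuA.
have Z0 := moment_ge0 HZ.
have h := cutoff_site_bound 1 HZ (ltr0Sn R n) nuA.
have w : \int[nu]_t invmin n.+1%:R t <= n.+1%:R.
  apply: (@le_trans _ _ (\int[nu]_t (cst (n.+1%:R : R) : T -> R) t)).
    apply: le_Rintegral => //; [apply: Cb_integrable|apply: Cb_integrable|].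
    - exact: Cb_invmin.
    - exact: Cb_cst.
    - by move=> t _; apply: invmin_le.
  rewrite Rintegral_cst// -[leRHS]mulr1 ler_wpM2l// -lee_fin fineK//.
  exact: fin_num_measure.
have := ler_wpM2l Z0 hn; rewrite !mul1r in h *.
by move: h w; set J := \int[nu]_t _; set I := ln _; lra.
Qed.

(** Uniform integrability of 1/t. The test is a large multiple K + 1 of the cutoff:
    the logarithmic term costs at most C / 2 for each K, so the part of 1/t
    above the level a has integral at most (A + C) / (K + 1). *)
Lemma site_tail (A C e : R) : 0 <= A -> 0 <= C -> 0 < e ->
  exists n : nat, forall (nu : {finite_measure set T -> \bar R}) Z,
  (\int[nu]_t tinv t = Z%:E)%E -> Z <= C -> site_bound nu Z A ->
  Z - \int[nu]_t invmin n.+1%:R t <= e.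
Proof.
move=> A0 C0 e0; pose K := (A + C) / e.
have K0 : 0 <= K by rewrite divr_ge0 ?addr_ge0// ltW.
(* K + 1 instead of K, so that the factor is positive even if A = C = 0 *)
have [n hn] := exp_cutoff_small (addr_ge0 K0 ler01).
exists n => nu Z HZ ZC nuA.
have Z0 := moment_ge0 HZ.
have h := cutoff_site_bound (K + 1) HZ (ltr0Sn R n) nuA.
have K1 : 0 < K + 1 by rewrite ltr_wpDl.
rewrite -(ler_pM2l K1); have := ler_wpM2l Z0 hn.
have Ke : K * e = A + C by rewrite /K divfK// gt_eqF.
move: h; rewrite [(K + 1) * e]mulrDl Ke mul1r.
by set J := _ * (Z - _); set I := ln _; lra.
Qed.

End one_site.

(** * Mass at infinity *)

Section mass_at_infinity.
Context (R : realType).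
Notation T := (ebar_nneg R).

(** The function (1 - n / t)^+, continuous on [0, +oo] and equal to 1 at +oo. *)
Definition escape (n : R) (t : T) : R := 1 - n * invmin n^-1 t.

Lemma escape_fin (n : R) (t : T) (r : R) : 0 < n -> 0 < r -> ebarval t = r%:E ->
  escape n t = 1 - Num.min r n / r.
Proof.
move=> n0 r0 tr; have in0 : 0 < n^-1 by rewrite invr_gt0.
rewrite /escape (invmin_fin in0 r0 tr); have [h|h] := leP r n.
  by rewrite min_r ?divff ?gt_eqF// lef_pV2.
by rewrite min_l// lef_pV2// ltW.
Qed.

Lemma escape_y (n : R) (t : T) : 0 < n -> ebarval t = +oo%E -> escape n t = 1.
Proof. by move=> n0 ty; rewrite /escape invmin_y ?mulr0 ?subr0 ?invr_gt0. Qed.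

Lemma escape_ge0 (n : R) (t : T) : 0 < n -> 0 <= escape n t.
Proof.
move=> n0; rewrite subr_ge0 mulrC -ler_pdivlMr// mul1r; apply: invmin_le.
by rewrite invr_gt0.
Qed.

Lemma escape_le1 (n : R) (t : T) : 0 < n -> escape n t <= 1.
Proof.
move=> n0; rewrite gerBl; apply: mulr_ge0; [exact: ltW|apply: invmin_ge0].
by rewrite invr_gt0.
Qed.

Lemma Cb_escape (n : R) : 0 < n -> Cb (escape n : T -> R).
Proof.
move=> n0; have in0 : 0 < n^-1 by rewrite invr_gt0.
split; last first.
  apply: (@bounded_fun_intro _ _ _ 1) => t.
  by rewrite ger0_norm ?escape_ge0// escape_le1.
move=> t; apply: (@continuousB _ _ _ (cst (1 : R)) (fun t => n * invmin n^-1 t)).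
  exact: cst_continuous.
apply: (@continuousM _ _ (cst n) (invmin n^-1)); first exact: cst_continuous.
exact: continuous_invmin.
Qed.

(** The function min ((t - n)^+, m), a bounded substitute for [excess]. *)
Definition ramp (n m : R) (t : T) : R := tmin (n + m) t - tmin n t.

Lemma Cb_ramp (n m : R) : 0 < n -> 0 < m -> Cb (ramp n m).
Proof.
move=> n0 m0; have nm0 : 0 < n + m by rewrite addr_gt0.
have [c1 /bounded_fun_ex[B1 _ hB1]] := Cb_tmin nm0.
have [c2 /bounded_fun_ex[B2 _ hB2]] := Cb_tmin n0.
split; first by move=> t; apply: continuousB; [exact: c1|exact: c2].
apply: (@bounded_fun_intro _ _ _ (B1 + B2)) => t.
by rewrite (le_trans (ler_normB _ _))// lerD.
Qed.

Lemma ramp_le_excess (n m r : R) (t : T) : 0 < n -> 0 < m -> 0 < r ->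
  ebarval t = r%:E -> ramp n m t <= excess n t.
Proof.
move=> n0 m0 r0 tr; have nm0 : 0 < n + m by rewrite addr_gt0.
rewrite /ramp /excess /tfin tr /= (tmin_fin nm0 (ltW r0) tr) (tmin_fin n0 (ltW r0) tr).
by have [h1|h1] := leP r (n + m); have [h2|h2] := leP r n; have [h3|h3] := leP (r - n) 0; lra.
Qed.

Definition far (a : R) : set T := [set t | (a%:E <= ebarval t)%E].

Lemma measurable_far a : measurable (far a).
Proof.
apply: (@measurable_preT R [set y | (a%:E <= y)%E]).
by rewrite -set_itvcy; exact: emeasurable_itv.
Qed.

(** Below n + m the ramp is (t - n)^+, and its product with 1/t is (1 - n / t)^+;
    from n + m on, +oo included, the indicator is enough. *)
Lemma escape_le_ramp (n m : R) (t : T) : 0 < n -> 0 < m -> ebarval t != 0%E ->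
  escape n t <= ramp n m t * trec t + \1_(far (n + m)) t.
Proof.
move=> n0 m0; have nm0 : 0 < n + m by rewrite addr_gt0.
case: (T_cases t) => [ty|[r r0 tr]] t0.
  by rewrite escape_y// rec_y// mulr0 add0r indicE mem_set// /far/= ty leey.
have {}r0 : 0 < r by rewrite lt_neqAle eq_sym r0 andbT; move: t0; rewrite tr.
rewrite (escape_fin n0 r0 tr) (rec_fin r0 tr).
rewrite /ramp (tmin_fin nm0 (ltW r0) tr) (tmin_fin n0 (ltW r0) tr).
rewrite indicE; have [h|h] := leP (n + m) r.
  rewrite mem_set /far/= ?tr ?lee_fin//.
  have nr : n <= r by rewrite (le_trans _ h)// lerDl ltW.
  rewrite (min_r nr) [n + m]addrC addrK.
  have := divr_ge0 (ltW n0) (ltW r0); have := divr_ge0 (ltW m0) (ltW r0); lra.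
rewrite memNset /far/= ?tr ?lee_fin; last by apply/negP; rewrite -ltNge.
by rewrite addr0 mulrBl divff ?gt_eqF.
Qed.

Variable psi : probability T R.
Hypotheses (psi0 : psi [set t | ebarval t = 0%E] = 0%E)
  (psiy : psi [set t | ebarval t = +oo%E] = 0%E).

(** The set of exponents of which [xi] is the supremum. *)
Definition admissible (c : R) :=
  0 <= c /\ (\int[psi]_t expeR (c%:E * ebarval t) < +oo)%E.

Lemma measurable_tfin : measurable_fun setT (@tfin R).
Proof. by apply: measurableT_comp => //; exact: measurable_ebarval. Qed.

Lemma measurable_excess n : measurable_fun setT (@excess R n).
Proof.
apply: measurable_maxr => //.
by apply: measurable_funB => //; exact: measurable_tfin.
Qed.

Lemma tfin_ge0 (t : T) : 0 <= tfin t.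
Proof. by rewrite fine_ge0// ebarval_ge0. Qed.

Lemma admissible_integrable c : admissible c ->
  psi.-integrable setT (EFin \o (fun t => expR (c * tfin t))).
Proof.
move=> [c0 hc].
have me : measurable_fun setT (fun t : T => expR (c * tfin t)).
  by apply: measurableT_comp => //; apply: measurable_funM => //; exact: measurable_tfin.
apply/integrableP; split; first exact/measurable_EFinP.
apply: le_lt_trans hc; apply: ge0_le_integral => //.
- by apply: measurableT_comp => //; exact/measurable_EFinP.
- rewrite (_ : (fun t : T => _) = (fun t : T => if (ebarval t == +oo)%E
      then expeR (c%:E * +oo) else (expR (c * tfin t))%:E)).
    apply: measurable_fun_ifT => //; last exact/measurable_EFinP.
    by apply: measurable_fun_eqe => //; exact: measurable_ebarval.
  apply/funext => t; case: (T_cases t) => [->//|[r r0 tr]].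
  by rewrite /tfin tr.
- move=> t _ /=; rewrite ger0_norm ?expR_ge0//.
  case: (T_cases t) => [ty|[r r0 tr]]; last by rewrite /tfin tr -EFinM.
  rewrite /tfin ty/= mulr0 expR0 -expeR0 lee_expeR mule_ge0//.
Qed.

(** One dominating function serves all levels above n. *)
Lemma excess_integrable c n (f : T -> R) : admissible c -> 0 <= n -> Cb f ->
  exists2 g : T -> R, psi.-integrable setT (EFin \o g) &
  forall m t, n <= m -> `|expR (f t + c * excess m t)| <= g t.
Proof.
move=> ac n0 [_ /bounded_fun_ex[H H0 fH]].
exists (fun t => expR H * expR (c * tfin t)).
  have := integrableZl measurableT (expR H) (admissible_integrable ac).
  by apply: eq_integrable => // t _ /=; rewrite EFinM.
move=> m t nm; rewrite ger0_norm ?expR_ge0// -expRD ler_expR lerD//.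
  by rewrite (le_trans (ler_norm _)).
apply: ler_wpM2l; first exact: ac.1.
by rewrite /excess ge_max tfin_ge0 gerBl (le_trans n0).
Qed.

Lemma measurable_exp_excess c n (f : T -> R) : measurable_fun setT f ->
  measurable_fun setT (fun t => expR (f t + c * excess n t)).
Proof.
move=> mf; apply: measurableT_comp => //; apply: measurable_funD => //.
by apply: measurable_funM => //; exact: measurable_excess.
Qed.

(** At a finite time the excess vanishes for large n, and psi does not charge +oo. *)
Lemma exp_excess_cvg c (f : T -> R) : admissible c -> Cb f ->
  \int[psi]_t expR (f t + c * excess n.+1%:R t) @[n --> \oo] -->
  \int[psi]_t expR (f t).
Proof.
move=> ac fC; have mf := Cb_measurable_T fC.
have [g ig fg] := excess_integrable ac (lexx 0) fC.
apply: (@Rdominated_cvg R psi _ _ g) => //.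
- by move=> n; exact: measurable_exp_excess.
- exact: measurableT_comp.
- apply: filterS (ae_pos_finite psi0 psiy) => t [r r0 tr]; apply: cvg_near_cst.
  near=> n; rewrite /excess /tfin tr /= max_r ?mulr0 ?addr0//.
  rewrite subr_le0 (@le_trans _ _ n%:R)// ?ler_nat//.
  near: n; exact: nbhs_infty_ger.
- by move=> n t; exact: fg.
Unshelve. all: by end_near. Qed.

Lemma escape_le_ramp_everywhere (n m : R) (t : T) : 0 < n -> 0 < m ->
  escape n t <= ramp n m t * trec t + \1_(far (n + m)) t.
Proof.
move=> n0 m0; have [t0|t0] := eqVneq (ebarval t) 0%E; last exact: escape_le_ramp.
rewrite /escape invmin_0 ?invr_gt0// divff ?gt_eqF// subrr.
by rewrite rec_0// mulr0 add0r.
Qed.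

(** The integrands are compared almost everywhere: at +oo the ramp equals m, while
    the excess has its default value. *)
Lemma exp_ramp_le c n m (f : T -> R) : admissible c -> 0 < n -> 0 < m -> Cb f ->
  \int[psi]_t expR (f t + c * ramp n m t) <=
  \int[psi]_t expR (f t + c * excess n t).
Proof.
move=> ac n0 m0 fC; have mf := Cb_measurable_T fC.
have rC : Cb (fun t => f t + c * ramp n m t).
  exact: (CbD fC (CbM (Cb_cst c) (Cb_ramp n0 m0))).
have mr : measurable_fun setT (fun t => expR (f t + c * ramp n m t)).
  by apply: measurableT_comp => //; exact: Cb_measurable_T.
have me := measurable_exp_excess c n mf.
have [g ig fg] := excess_integrable ac (ltW n0) fC.
have ie : psi.-integrable setT (EFin \o (fun t => expR (f t + c * excess n t))).
  apply: le_integrable ig => //; first exact/measurable_EFinP.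
  by move=> t _ /=; rewrite lee_fin (le_trans (fg n t (lexx n)))// ler_norm.
have ir : psi.-integrable setT (EFin \o (fun t => expR (f t + c * ramp n m t))).
  apply: bounded_integrable => //; first exact: fin_num_measure.
  exact: bounded_expR rC.2.
rewrite /Rintegral; apply: fine_le; [exact: integrable_fin_num..|].
apply: ae_ge0_le_integral => //.
- exact/measurable_EFinP.
- exact/measurable_EFinP.
- apply: filterS (ae_pos_finite psi0 psiy) => t [r r0 tr] _.
  rewrite lee_fin ler_expR lerD2l; apply: ler_wpM2l; first exact: ac.1.
  exact: ramp_le_excess r0 tr.
Qed.

Lemma exp_excess_gt0 c n (f : T -> R) : admissible c -> 0 < n -> Cb f ->
  0 < \int[psi]_t expR (f t + c * excess n t).
Proof.
move=> ac n0 fC; apply: lt_le_trans (exp_ramp_le ac n0 ltr01 fC).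
have rC : Cb (fun t => f t + c * ramp n 1 t).
  exact: (CbD fC (CbM (Cb_cst c) (Cb_ramp n0 ltr01))).
apply: exp_moment_gt0 => //.
- by rewrite fin_num_measure.
- by have := @lte01 R; rewrite -(probability_setT psi).
- exact: Cb_measurable_T.
- exact: rC.2.
Qed.

Lemma far_cvg (nu : {finite_measure set T -> \bar R}) (n : R) :
  fine (nu (far (n + m.+1%:R))) @[m --> \oo] --> fine (nu [set t | ebarval t = +oo%E]).
Proof.
apply: fine_cvg; rewrite fineK; last first.
  by apply: fin_num_measure; exact: measurable_point.
have -> : [set t : T | ebarval t = +oo%E] = \bigcap_m far (n + m.+1%:R).
  apply/seteqP; split => [t /= ty m _|t h /=]; first by rewrite /far/= ty leey.
  case: (T_cases t) => [//|[r r0 tr]].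
  have := h (Num.truncn (`|n| + r)) I; rewrite /far/= tr lee_fin leNgt => /negP[].
  rewrite -ltrBlDl (le_lt_trans _ (truncnS_gt _))// addrC lerD2r.
  by rewrite -normrN ler_norm.
apply: nonincreasing_cvg_mu.
- by rewrite ltey_eq fin_num_measure//; exact: measurable_far.
- by move=> m; exact: measurable_far.
- by apply: bigcapT_measurable => m; exact: measurable_far.
- move=> m k mk; apply/subsetPset => t; apply: le_trans.
  by rewrite lee_fin lerD2l ler_nat.
Qed.

(** Test with f plus c times the ramp. The product of the ramp with 1/t dominates
    the escape function except beyond n + m, and the mass there decreases to the
    mass at +oo as m -> +oo; on the side of psi the ramp is at most the excess.
    The result is a lower bound for the entropy and the mass at +oo together
    whose left-hand side is continuous in nu, although the mass at +oo is not. *)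
Lemma site_mixed (nu : {finite_measure set T -> \bar R}) (Z A c n : R) (f : T -> R) :
  (\int[nu]_t tinv t = Z%:E)%E -> site_bound psi nu Z A -> admissible c ->
  0 < n -> Cb f ->
  \int[nu]_t (f t * trec t) + c * \int[nu]_t escape n t -
    Z * ln (\int[psi]_t expR (f t + c * excess n t)) <=
  A + c * fine (nu [set t | ebarval t = +oo%E]).
Proof.
move=> HZ nuA ac n0 fC; have c0 := ac.1; have Z0 := moment_ge0 HZ.
have mf := Cb_measurable_T fC.
set K := \int[psi]_t _.
set B := _ - _.
have hm (m : nat) : B <= A + c * fine (nu (far (n + m.+1%:R))).
  have m0 : 0 < m.+1%:R :> R by [].
  have RC := Cb_ramp n0 m0.
  have rC : Cb (fun t => f t + c * ramp n m.+1%:R t).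
    exact: (CbD fC (CbM (Cb_cst c) RC)).
  have i1 := integrable_mul_rec HZ mf fC.2.
  have i2 := integrable_mul_rec HZ (Cb_measurable_T RC) RC.2.
  have := nuA _ rC.
  have -> : \int[nu]_t ((f t + c * ramp n m.+1%:R t) * trec t) =
      \int[nu]_t (f t * trec t) + c * \int[nu]_t (ramp n m.+1%:R t * trec t).
    rewrite -RintegralZl// -RintegralD//; last first.
      have := integrableZl measurableT c i2.
      by apply: eq_integrable => // t _ /=; rewrite EFinM.
    by apply: eq_Rintegral => t _; rewrite mulrDl mulrA.
  have h1 : \int[nu]_t escape n t <= \int[nu]_t (ramp n m.+1%:R t * trec t) +
      fine (nu (far (n + m.+1%:R))).
    have ifar : nu.-integrable setT (EFin \o (\1_(far (n + m.+1%:R)) : T -> R)).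
      apply: bounded_integrable; first exact: fin_num_measure.
        by apply: measurable_indic; exact: measurable_far.
      by apply: (@bounded_fun_intro _ _ _ 1) => t; rewrite indicE normr_nat; case: (_ \in _).
    have -> : fine (nu (far (n + m.+1%:R))) = \int[nu]_t \1_(far (n + m.+1%:R)) t.
      by rewrite /Rintegral integral_indic ?setIT//; exact: measurable_far.
    rewrite -RintegralD//; apply: le_Rintegral => //.
    - by apply: Cb_integrable; exact: Cb_escape.
    - have := integrableD measurableT i2 ifar.
      by apply: eq_integrable => // t _ /=; rewrite EFinD.
    - by move=> t _; exact: escape_le_ramp_everywhere.
  have h2 : ln (\int[psi]_t expR (f t + c * ramp n m.+1%:R t)) <= ln K.
    rewrite ler_ln ?posrE; [exact: exp_ramp_le| |exact: exp_excess_gt0].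
    apply: exp_moment_gt0 => //.
    - by rewrite fin_num_measure.
    - by have := @lte01 R; rewrite -(probability_setT psi).
    - exact: Cb_measurable_T.
    - exact: rC.2.
  have := ler_wpM2l c0 h1; have := ler_wpM2l Z0 h2; rewrite /B mulrDr.
  by set a1 := ln _; set a2 := \int[nu]_t (_ * _); lra.
have cv : A + c * fine (nu (far (n + m.+1%:R))) @[m --> \oo] -->
    A + c * fine (nu [set t | ebarval t = +oo%E]).
  by apply: cvgD; [exact: cvg_cst|apply: cvgM; [exact: cvg_cst|exact: far_cvg]].
by apply: (cvgr_to_ge cv); exact: nearW.
Qed.

(** The converse of [site_mixed] for large n: the exponential moments tend to that
    of f, and the escape functions dominate the indicator of +oo. *)
Lemma site_recover (nu : {finite_measure set T -> \bar R}) (Z c s : R) (f : T -> R) :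
  admissible c -> Cb f ->
  s < \int[nu]_t (f t * trec t) + c * fine (nu [set t | ebarval t = +oo%E]) -
    Z * ln (\int[psi]_t expR (f t)) ->
  exists n : nat, s < \int[nu]_t (f t * trec t) + c * \int[nu]_t escape n.+1%:R t -
    Z * ln (\int[psi]_t expR (f t + c * excess n.+1%:R t)).
Proof.
move=> ac fC; set L := _ - _ => sL.
have K0 : 0 < \int[psi]_t expR (f t).
  apply: exp_moment_gt0 => //.
  - by rewrite fin_num_measure.
  - by have := @lte01 R; rewrite -(probability_setT psi).
  - exact: Cb_measurable_T.
  - exact: fC.2.
have cv : \int[nu]_t (f t * trec t) + c * fine (nu [set t | ebarval t = +oo%E]) -
    Z * ln (\int[psi]_t expR (f t + c * excess n.+1%:R t)) @[n --> \oo] --> L.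
  apply: cvgB; first exact: cvg_cst.
  apply: cvgM; first exact: cvg_cst.
  apply: (@cvg_comp _ _ _ (fun n : nat => \int[psi]_t expR (f t + c * excess n.+1%:R t)) (@ln R)).
    exact: (exp_excess_cvg ac fC).
  exact: continuous_ln.
have [n _ hn] := cvgr_gt _ cv _ sL.
exists n; apply: (lt_le_trans (hn n _)) => //=.
rewrite lerD2r lerD2l; apply: ler_wpM2l; first exact: ac.1.
have my := @measurable_point R +oo%E.
have -> : fine (nu [set t | ebarval t = +oo%E]) =
    \int[nu]_t (\1_[set t : T | ebarval t = +oo%E] t : R).
  by rewrite /Rintegral integral_indic ?setIT.
apply: le_Rintegral => //.
- apply: bounded_integrable; first exact: fin_num_measure.
    exact: measurable_indic.
  by apply: (@bounded_fun_intro _ _ _ 1) => t; rewrite indicE normr_nat; case: (_ \in _).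
- by apply: Cb_integrable; exact: Cb_escape.
- move=> t _; rewrite indicE; have [|_] := boolP (t \in _).
    by rewrite inE /= => ty; rewrite escape_y.
  exact: escape_ge0.
Qed.

End mass_at_infinity.

(** * Sums of suprema and convergence of fluxes *)

Lemma ultra_fmap (I U : Type) (W : set_system I) (f : I -> U) :
  UltraFilter W -> UltraFilter (f i @[i --> W]).
Proof.
move=> UW; split; first exact: fmap_proper_filter.
move=> G PG sWG; apply/seteqP; split => // A GA.
have [//|WA] := in_ultra_setVsetC (f @^-1` A) UW.
have GnA : G (~` A) by apply: sWG.
by have := filter_ex (filterI GA GnA) => -[u []].
Qed.

Section sums_from_below.
Context (R : realType) (J : finType).

(** This lets each summand, a supremum, be approached by a value of its own. A
    summand +oo is excluded by a large value there and -1 elsewhere. *)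
Lemma esum_le_from_below (X : J -> \bar R) (M : R) : (forall j, 0 <= X j)%E ->
  (forall s : J -> R, (forall j, (s j)%:E < X j)%E -> \sum_(j : J) s j <= M) ->
  (\sum_(j : J) X j <= M%:E)%E.
Proof.
move=> X0 h.
have Xfin j : X j \is a fin_num.
  rewrite ge0_fin_numE// ltNge leye_eq; apply/negP => /eqP Xj.
  pose s i := if i == j then `|M| + #|J|%:R + 1 else -1 : R.
  have : \sum_(i : J) s i <= M.
    apply: h => i; rewrite /s; case: eqP => [->|_]; first by rewrite Xj ltry.
    by apply: lt_le_trans (X0 i); rewrite lte_fin ltrN10.
  apply/negP; rewrite -ltNge (bigD1 j)//= {1}/s eqxx.
  rewrite (eq_bigr (fun=> -1)); last by move=> i ij; rewrite /s (negbTE ij).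
  rewrite sumr_const mulNrn.
  have c : #|(fun i : J => i != j)|%:R <= #|J|%:R :> R by rewrite ler_nat max_card.
  have := ler_norm M; move: c.
  by set a := _%:R; set b := _%:R; lra.
rewrite (eq_bigr (fun j => (fine (X j))%:E)); last by move=> j _; rewrite fineK.
rewrite sumEFin lee_fin; apply/ler_addgt0Pr => e e0.
have c0 : 0 < (#|J|.+1)%:R :> R by [].
have : \sum_(j : J) (fine (X j) - e / #|J|.+1%:R) <= M.
  apply: h => j; rewrite -[ltRHS]fineK// lte_fin ltrBlDr ltrDl.
  by rewrite divr_gt0.
rewrite sumrB lerBlDr => /le_trans; apply; rewrite lerD2l sumr_const.
rewrite -[leLHS]mulr_natr mulrAC ler_pdivrMr// ler_pM2l// ler_nat.
exact: leqnSn.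
Qed.

End sums_from_below.

Section Lambda_topology.
Context (R : realType) (E : finPointedType).
Notation T := (ebar_nneg R).
Notation D := (discrete_topology E).
Notation X := (discrete_topology E * ebar_nneg R)%type.

Lemma nbhs_discrete2 (z : D * D) : nbhs z [set z].
Proof.
case: z => x y; exists ([set x], [set y]) => /=; last by move=> [a b] /= [-> ->].
by split; apply: open_nbhs_nbhs; split => //; exact: discrete_open.
Qed.

Lemma flux_of (q : E -> E -> R) : (forall x y, 0 <= q x y) ->
  exists Q : unif_cts (D * D)%type (real_nneg R), flux Q = q.
Proof.
move=> q0.
have qP (z : D * D) : q z.1 z.2 \in (`[0 : R, +oo[%classic : set R).
  by rewrite inE /= in_itv /= q0.
pose g (z : (D * D)%type) : real_nneg R := SigSub (qP z).
have cg : continuous g.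
  move=> z A /= nA; apply: filterS (nbhs_discrete2 z) => _ ->.
  exact: nbhs_singleton nA.
pose Q : continuousType (D * D)%type (real_nneg R) :=
  HB.pack g (isContinuous.Build _ _ g cg).
by exists Q.
Qed.

(** On the finite set E * E uniform convergence is pointwise. *)
Lemma unif_cts_cvg (F : set_system (unif_cts (D * D)%type (real_nneg R)))
    (Q : unif_cts (D * D)%type (real_nneg R)) : Filter F ->
  (forall x y, flux Q' x y @[Q' --> F] --> flux Q x y) -> F --> Q.
Proof.
move=> FF h; apply/cvg_initialP => P /uniform_nbhs[B [entB sB]].
pose ev (Q' : unif_cts (D * D)%type (real_nneg R)) (z : D * D) : real_nneg R :=
  (Q' : continuousType (D * D)%type (real_nneg R)) z.
have : \forall Q' \near F, forall z : E * E, B (ev Q z, ev Q' z).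
  apply: filter_forall => -[x y].
  have hz : (fun Q' => ev Q' (x, y)) @ F --> ev Q (x, y).
    by apply/cvg_initialP; exact: (h x y).
  exact: (cvg_entourage hz entB).
by apply: filterS => Q' hQ'; apply: sB => z _; exact: hQ'.
Qed.

End Lambda_topology.

(** * The rate as a sum of costs *)

Section sublevel.
Context (R : realType) (E : finPointedType).
Notation T := (ebar_nneg R).
Notation D := (discrete_topology E).
Notation X := (discrete_topology E * ebar_nneg R)%type.
Variables (p : E -> E -> R) (psi : E -> probability T R).
Hypotheses (p_markov : markov_kernel p)
  (psi0 : forall x, psi x [set t | ebarval t = 0%E] = 0%E)
  (psiy : forall x, psi x [set t | ebarval t = +oo%E] = 0%E).

Definition law (L : Lambda R E) : probability X R := L.1.
Definition total_flux (Q : E -> E -> R) (x : E) : R := \sum_(y : E) Q x y.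

Lemma flux_nneg (Q : unif_cts (D * D)%type (real_nneg R)) x y : 0 <= flux Q x y.
Proof.
by have := set_valP ((Q : continuousType _ _) (x, y)); rewrite /= in_itv/= andbT.
Qed.

Definition jump_cost (Q : E -> E -> R) (x : E) : \bar R :=
  (entropy (weights (pQ p Q x)) (weights (p x)) * (total_flux Q x)%:E)%E.
Definition hold_cost (mu : probability X R) (Q : E -> E -> R) (x : E) : \bar R :=
  (entropy (psimu psi mu Q x) (psi x) * (total_flux Q x)%:E)%E.
Definition escape_cost (mu : probability X R) (x : E) : \bar R :=
  (xi (psi x) * slice mu x [set t | ebarval t = +oo%E])%E.

Lemma admissible0 x : admissible (psi x) 0.
Proof.
split => //; under eq_integral do rewrite mul0e expeR0.
by rewrite integral_cst// mul1e ltey_eq fin_num_measure.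
Qed.

Lemma xi_ge x c : admissible (psi x) c -> (c%:E <= xi (psi x))%E.
Proof. by move=> ac; apply: ereal_sup_ubound; exists c. Qed.

Lemma xi_ge0 x : (0 <= xi (psi x))%E.
Proof. exact: (xi_ge (admissible0 x)). Qed.

Section one_point.
Variables (mu : probability X R) (Q : E -> E -> R).
Hypotheses (Q0 : forall x y, 0 <= Q x y) (LQ : Lambda0 mu Q).

Lemma Lambda0_moment x : (\int[slice mu x]_t tinv t = (total_flux Q x)%:E)%E.
Proof. exact: (LQ x).1. Qed.

Lemma jump_cost_ge0 x : (0 <= jump_cost Q x)%E.
Proof.
by rewrite mule_ge0 ?lee_fin ?flux_ge0//; exact: jump_entropy_ge0.
Qed.

Lemma hold_cost_ge0 x : (0 <= hold_cost mu Q x)%E.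
Proof.
rewrite mule_ge0 ?lee_fin ?flux_ge0//; apply: hold_entropy_ge0 => //.
exact: Lambda0_moment.
Qed.

Lemma escape_cost_ge0 x : (0 <= escape_cost mu x)%E.
Proof. by rewrite mule_ge0// xi_ge0. Qed.

Lemma rate_terms :
  (\sum_(x : E) \int[slice mu x]_t
       ((entropy (weights (pQ p Q x)) (weights (p x)) +
         entropy (psimu psi mu Q x) (psi x)) / ebarval t +
        xi (psi x) * (\1_[set +oo%E] (ebarval t))%:E) =
   \sum_(x : E) (jump_cost Q x + (hold_cost mu Q x + escape_cost mu x)))%E.
Proof.
apply: eq_bigr => x _.
have j0 := jump_entropy_ge0 p_markov Q0 x.
have h0 : (0 <= entropy (psimu psi mu Q x) (psi x))%E.
  by apply: hold_entropy_ge0 => //; exact: Lambda0_moment.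
rewrite (rate_integral (Lambda0_moment x)); last 2 first.
- exact: adde_ge0.
- exact: xi_ge0.
by rewrite ge0_muleDl// addeA.
Qed.

End one_point.

Lemma rate_le_cost (L : Lambda R E) (M : R) : (rate p psi L <= M%:E)%E ->
  Lambda0 (law L) (flux L.2) /\
  (\sum_(x : E) (jump_cost (flux L.2) x +
     (hold_cost (law L) (flux L.2) x + escape_cost (law L) x)) <= M%:E)%E.
Proof.
rewrite /rate; case: asboolP => // LQ h; split => //.
by rewrite -rate_terms//; exact: flux_nneg.
Qed.

Lemma rate_of_cost (L : Lambda R E) (M : R) : Lambda0 (law L) (flux L.2) ->
  (\sum_(x : E) (jump_cost (flux L.2) x +
     (hold_cost (law L) (flux L.2) x + escape_cost (law L) x)) <= M%:E)%E ->
  (rate p psi L <= M%:E)%E.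
Proof.
move=> LQ h; rewrite /rate; case: asboolP => // _.
by rewrite rate_terms//; exact: flux_nneg.
Qed.

Section in_sublevel.
Variables (mu : probability X R) (Q : E -> E -> R) (M : R).
Hypotheses (Q0 : forall x y, 0 <= Q x y) (LQ : Lambda0 mu Q).
Hypothesis costM : (\sum_(x : E) (jump_cost Q x +
     (hold_cost mu Q x + escape_cost mu x)) <= M%:E)%E.

Let cost_ge0 x : (0 <= jump_cost Q x + (hold_cost mu Q x + escape_cost mu x))%E.
Proof. by rewrite !adde_ge0// ?jump_cost_ge0 ?hold_cost_ge0 ?escape_cost_ge0. Qed.

Lemma hold_cost_le x : (hold_cost mu Q x <= M%:E)%E.
Proof.
apply: le_trans costM; rewrite (bigD1 x)//=.
apply: (@le_trans _ _ (jump_cost Q x + (hold_cost mu Q x + escape_cost mu x))%E).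
  apply: (@le_trans _ _ (hold_cost mu Q x + escape_cost mu x)%E).
    by rewrite leeDl// escape_cost_ge0.
  by rewrite leeDr// jump_cost_ge0.
by rewrite leeDl// sume_ge0.
Qed.

Lemma hold_cost_fin x : hold_cost mu Q x = (fine (hold_cost mu Q x))%:E.
Proof.
rewrite fineK// ge0_fin_numE ?hold_cost_ge0//.
by rewrite (le_lt_trans (hold_cost_le x))// ltry.
Qed.

Lemma sublevel_site_bound x :
  site_bound (psi x) (slice mu x) (total_flux Q x) (fine (hold_cost mu Q x)).
Proof.
move=> f fC; rewrite -lee_fin -hold_cost_fin.
exact: (@hold_entropy_test _ _ _ _ _ Q0 x (Lambda0_moment LQ x) f fC).
Qed.

Lemma sublevel_site_bound_le x :
  site_bound (psi x) (slice mu x) (total_flux Q x) M.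
Proof.
move=> f fC; apply: (le_trans (@sublevel_site_bound x f fC)).
by rewrite -lee_fin -hold_cost_fin hold_cost_le.
Qed.

(** The left-hand side of [site_mixed]: it depends on nu through integrals that
    converge with the law and with uniformly integrable inverse times. *)
Definition site_functional (nu : {finite_measure set T -> \bar R}) (Z : R)
    (x : E) (c n : R) (f : T -> R) : R :=
  \int[nu]_t (f t * trec t) + c * \int[nu]_t escape n t -
    Z * ln (\int[psi x]_t expR (f t + c * excess n t)).

(** Each site pays its own costs, and the admissible exponent c is at most [xi]. *)
Lemma sublevel_tests (g : E -> E -> R) (f : E -> T -> R) (c n : E -> R) :
  (forall x, Cb (f x)) -> (forall x, admissible (psi x) (c x)) ->
  (forall x, 0 < n x) ->
  \sum_(x : E) (jump_test p Q x (g x) +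
    site_functional (slice mu x) (total_flux Q x) x (c x) (n x) (f x)) <= M.
Proof.
move=> fC ac n0; rewrite -lee_fin; apply: le_trans costM.
rewrite -sumEFin; apply: lee_sum => x _; rewrite EFinD; apply: leeD.
  exact: jump_entropy_test.
have h := site_mixed (psi0 x) (psiy x) (Lambda0_moment LQ x)
  (@sublevel_site_bound x) (ac x) (n0 x) (fC x).
apply: (@le_trans _ _ (fine (hold_cost mu Q x) +
    c x * fine (slice mu x [set t | ebarval t = +oo%E]))%:E).
  by rewrite lee_fin.
rewrite EFinD -hold_cost_fin leeD2l// EFinM fineK.
  by apply: lee_wpmul2r => //; exact: xi_ge.
by apply: fin_num_measure; exact: measurable_point.
Qed.

End in_sublevel.

(** The suprema over jump tests, holding tests and admissible exponents are
    approached independently at each site; the level n is chosen last, by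
    [site_recover]. *)
Lemma cost_from_tests (mu : probability X R) (Q : E -> E -> R) (M : R) :
  (forall x y, 0 <= Q x y) -> Lambda0 mu Q ->
  (forall (g : E -> E -> R) (f : E -> T -> R) (c n : E -> R),
    (forall x, Cb (f x)) -> (forall x, admissible (psi x) (c x)) ->
    (forall x, 0 < n x) ->
    \sum_(x : E) (jump_test p Q x (g x) +
      site_functional (slice mu x) (total_flux Q x) x (c x) (n x) (f x)) <= M) ->
  (\sum_(x : E) (jump_cost Q x + (hold_cost mu Q x + escape_cost mu x)) <= M%:E)%E.
Proof.
move=> Q0 LQ tests.
(* all the costs in one sum, indexed by their kind and their site *)
pose J := (E + (E + E))%type.
pose Xc (j : J) := match j with
  | inl x => jump_cost Q x | inr (inl x) => hold_cost mu Q x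
  | inr (inr x) => escape_cost mu x end.
have -> : (\sum_(x : E) (jump_cost Q x + (hold_cost mu Q x + escape_cost mu x)) =
    \sum_(j : J) Xc j)%E.
  by rewrite !big_sumType/= -big_split/= -big_split.
apply: esum_le_from_below => [[x|[x|x]]|s hs] /=.
- exact: jump_cost_ge0.
- exact: hold_cost_ge0.
- exact: escape_cost_ge0.
have /choice[g hg] : forall x, exists g : E -> R, s (inl x) < jump_test p Q x g.
  by move=> x; apply: jump_entropy_approx => //; exact: (hs (inl x)).
have /choice[f hf] : forall x, exists f : T -> R,
    Cb f /\ s (inr (inl x)) < hold_test psi mu Q x f.
  move=> x; have [f fC sf] := hold_entropy_approx Q0 (Lambda0_moment LQ x) (hs (inr (inl x))).
  by exists f.
have /choice[c hc] : forall x, exists c : R, admissible (psi x) c /\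
    s (inr (inr x)) < c * fine (slice mu x [set t | ebarval t = +oo%E]).
  move=> x; have := hs (inr (inr x)); rewrite /Xc /escape_cost.
  set m := slice mu x _.
  have mfin : m \is a fin_num by apply: fin_num_measure; exact: measurable_point.
  have m0 : 0 <= fine m by apply: fine_ge0; exact: measure_ge0.
  rewrite -(fineK mfin) => h.
  move: m0; rewrite le_eqVlt => /predU1P[m0|m0].
    exists 0; split; first exact: admissible0.
    by move: h; rewrite -m0 mule0 mul0r lte_fin.
  move: h; rewrite -lte_pdivrMr// => /ereal_sup_gt[_ [c ac <-]].
  by rewrite lte_fin ltr_pdivrMr// => sc; exists c.
have /choice[n hn] : forall x, exists n : nat,
    s (inr (inl x)) + s (inr (inr x)) <
    site_functional (slice mu x) (total_flux Q x) x (c x) n.+1%:R (f x).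
  move=> x; apply: (site_recover (psi0 x) (psiy x) (hc x).1 (hf x).1).
  have := (hf x).2; have := (hc x).2; rewrite /hold_test -/(total_flux Q x).
  by set a := fine _; set b := ln _; lra.
apply: le_trans (tests g f c (fun x => (n x).+1%:R) _ _ _).
- rewrite !big_sumType/= -big_split/= -big_split/=; apply: ler_sum => x _.
  by apply: lerD; apply/ltW.
- by move=> x; exact: (hf x).1.
- by move=> x; exact: (hc x).1.
- by [].
Qed.

End sublevel.

(** * Passage to the limit *)

Section limits.
Context (R : realType) (E : finPointedType).
Notation T := (ebar_nneg R).
Notation D := (discrete_topology E).
Notation X := (discrete_topology E * ebar_nneg R)%type.

(** The fibre over x is open and closed, so a test on it extends by 0. *)
Lemma narrow_slice_cvg (I : Type) (W : set_system I) (FW : Filter W)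
    (mu_ : I -> narrow X R) (mu : narrow X R) (x : E) (f : T -> R) :
  mu_ i @[i --> W] --> mu -> Cb f ->
  \int[slice (mu_ i : probability X R) x]_t f t @[i --> W] -->
  \int[slice (mu : probability X R) x]_t f t.
Proof.
move=> mucv [cf bf]; pose phi (z : X) : R := if z.1 == x then f z.2 else 0.
have cphi : continuous phi.
  move=> [y t].
  have cy : {for t, continuous (fun s => phi (y, s))}.
    rewrite /phi/=; case: eqP => _; first exact: cf.
    exact: cst_continuous.
  move=> A nA.
  exists ([set y], [set s | A (phi (y, s))]) => /=.
    split; last exact: cy.
    by apply: open_nbhs_nbhs; split => //; exact: discrete_open.
  by move=> [a b] /= [-> ].
have [H H0 fH] := bounded_fun_ex bf.
have bphi : bounded_fun phi.
  apply: (@bounded_fun_intro _ _ _ H) => -[y t]; rewrite /phi/=.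
  by case: eqP => _ //; rewrite normr0.
have phiE (nu : probability X R) : \int[nu]_z phi z = \int[slice nu x]_t f t.
  rewrite Rintegral_slice//; last exact: continuous_measurable_X.
  rewrite (bigD1 x)//= big1 ?addr0.
    by apply: eq_Rintegral => t _; rewrite /phi/= eqxx.
  move=> y yx; rewrite /Rintegral integral0_eq// => t _.
  by rewrite /phi/= (negbTE yx).
have key : \int[(mu_ i : probability X R)]_z phi z @[i --> W] -->
    \int[(mu : probability X R)]_z phi z.
  exact: (narrow_cvgP mu _).1 mucv phi (conj cphi bphi).
have -> : \int[slice (mu : probability X R) x]_t f t =
  \int[(mu : probability X R)]_z phi z by rewrite phiE.
apply: cvg_trans key; apply: near_eq_cvg; apply: nearW => i.
exact: (phiE (mu_ i)).
Qed.

(** The function f / t is not bounded, but f times a truncation of 1/t is a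
    bounded continuous test, and the error is small uniformly along the filter. *)
Lemma weighted_rec_cvg (I : Type) (W : set_system I) (FW : ProperFilter W)
    (nu_ : I -> {finite_measure set T -> \bar R}) (nu : {finite_measure set T -> \bar R})
    (Z_ : I -> R) (Z : R) :
  (\forall i \near W, \int[nu_ i]_t tinv t = (Z_ i)%:E)%E ->
  (forall f : T -> R, Cb f -> \int[nu_ i]_t f t @[i --> W] --> \int[nu]_t f t) ->
  Z_ i @[i --> W] --> Z ->
  (forall e, 0 < e -> exists n : nat,
    \forall i \near W, Z_ i - \int[nu_ i]_t invmin n.+1%:R t <= e) ->
  (\int[nu]_t tinv t = Z%:E)%E /\
  (forall f : T -> R, Cb f -> \int[nu_ i]_t (f t * trec t) @[i --> W] -->
    \int[nu]_t (f t * trec t)).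
Proof.
move=> HZ nucv Zcv tail.
have n0 (n : nat) : 0 < n.+1%:R :> R by [].
have tcv n : Z_ i - \int[nu_ i]_t invmin n.+1%:R t @[i --> W] -->
    Z - \int[nu]_t invmin n.+1%:R t.
  by apply: cvgB => //; apply: nucv; exact: Cb_invmin.
have tail0 (n : nat) : 0 <= Z - \int[nu]_t invmin n.+1%:R t.
  apply: (cvgr_to_ge (tcv n)); apply: filterS HZ => i hi.
  have := tail_test hi 1 (n0 n); rewrite mul1r => <-.
  apply: Rintegral_ge0 => t _; rewrite mul1r; apply: mulr_ge0; last exact: rec_ge0.
  exact: cutoff_ge0.
have tailZ e : 0 < e -> exists n : nat, Z - \int[nu]_t invmin n.+1%:R t <= e.
  move=> e0; have [n hn] := tail e e0; exists n; exact: (cvgr_to_le (tcv n)).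
have HZ0 : (\int[nu]_t tinv t = Z%:E)%E.
  apply: inverse_moment_from_truncations => [n|e e0].
    by rewrite -subr_ge0.
  by have [n hn] := tailZ e e0; exists n; rewrite lerBlDr -lerBlDl.
split=> // f fC; have [H H00 fH] := bounded_fun_ex fC.2.
have mf := Cb_measurable_T fC.
apply/cvgrPdist_le => e e0.
(* one third of e for each of the two truncations, one for the limit at a fixed
   truncation *)
pose e1 := e / 3 / (H + 1).
have H1 : 0 < H + 1 by rewrite ltr_wpDl.
have e10 : 0 < e1 by rewrite !divr_gt0.
have He1 : H * e1 <= e / 3.
  by rewrite /e1 mulrCA ler_piMr ?divr_ge0 ?ltW// ltr_pdivrMr// mul1r ltrDl.
have e30 : 0 < e / 3 by rewrite divr_gt0.
have [n hn] := tail e1 e10.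
have hn0 : Z - \int[nu]_t invmin n.+1%:R t <= e1 by exact: (cvgr_to_le (tcv n)).
have fcv : \int[nu_ i]_t (f t * invmin n.+1%:R t) @[i --> W] -->
    \int[nu]_t (f t * invmin n.+1%:R t).
  by apply: nucv; exact: (CbM fC (Cb_invmin (n0 n))).
move/cvgrPdist_le: fcv => /(_ _ e30) fcv3.
near=> i.
have hi : (\int[nu_ i]_t tinv t = (Z_ i)%:E)%E by near: i.
have b1 := tail_bound hi (n0 n) mf fH.
have b2 := tail_bound HZ0 (n0 n) mf fH.
have b3 : `|\int[nu]_t (f t * invmin n.+1%:R t) -
            \int[nu_ i]_t (f t * invmin n.+1%:R t)| <= e / 3 by near: i.
have b4 : Z_ i - \int[nu_ i]_t invmin n.+1%:R t <= e1 by near: i.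
have {}b1 := le_trans b1 (le_trans (ler_wpM2l H00 b4) He1).
have {}b2 := le_trans b2 (le_trans (ler_wpM2l H00 hn0) He1).
move: b1 b2 b3; rewrite !ler_norml => /andP[? ?] /andP[? ?] /andP[? ?].
by apply/andP; split; lra.
Unshelve. all: by end_near. Qed.

End limits.

Lemma jump_test_cvg (R : realType) (E : finPointedType) (I : Type) (W : set_system I)
    (FW : Filter W) (p : E -> E -> R) (Q_ : I -> E -> E -> R) (Q : E -> E -> R) x g :
  (forall x y, Q_ i x y @[i --> W] --> Q x y) ->
  jump_test p (Q_ i) x g @[i --> W] --> jump_test p Q x g.
Proof.
move=> Qcv; rewrite /jump_test; apply: cvgB.
  by apply: cvg_finsum => y; apply: cvgM; [exact: Qcv|exact: cvg_cst].
by apply: cvgM; [apply: cvg_finsum => y; exact: Qcv|exact: cvg_cst].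
Qed.

Unset Implicit Arguments.

Theorem proposition1p1 (R : realType) (E : finPointedType) (p : E -> E -> R)
    (psi : E -> probability (ebar_nneg R) R)
    (p_markov : markov_kernel p) (p_irreducible : irreducible p)
    (psi0 : forall x, psi x [set t | ebarval t = 0%E] = 0%E)
    (psiy : forall x, psi x [set t | ebarval t = +oo%E] = 0%E)
    (M : R) (M_gt0 : 0 < M) :
  compact [set L : Lambda R E | (rate p psi L <= M%:E)%E].
Proof.
rewrite compact_ultra => W UW WS.
(* the sublevel set in terms of the costs *)
pose S (L : Lambda R E) := Lambda0 (law L) (flux L.2) /\
  (\sum_(x : E) (jump_cost p (flux L.2) x +
     (hold_cost psi (law L) (flux L.2) x + escape_cost psi (law L) x)) <= M%:E)%E.
have {}WS : \forall L \near W, S L.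
  by apply: filterS WS => L /=; exact: rate_le_cost.
pose Z (L : Lambda R E) x := total_flux (flux L.2) x.
have Q0 (L : Lambda R E) x y : 0 <= flux L.2 x y by exact: flux_nneg.
have moment L x : S L -> (\int[slice (law L) x]_t tinv t = (Z L x)%:E)%E.
  by move=> [LQ _]; exact: Lambda0_moment.
have site L x : S L -> site_bound (psi x) (slice (law L) x) (Z L x) M.
  by move=> [LQ cM]; exact: (sublevel_site_bound_le p_markov (Q0 L) LQ cM).
have slice1 (mu : probability _ R) x : (slice mu x setT <= 1)%E.
  by rewrite /slice; apply: probability_le1; exact: measurable_sliceX.
(* the flux is bounded on the sublevel set, hence converges along W *)
have /choice[C hC] : forall x, exists C, forall L, S L -> Z L x <= C.
  move=> x; have [B hB] := site_flux_bound (psi0 x) (psiy x) M.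
  exists B => L SL; apply: (hB (slice (law L) x)).
  - exact: moment.
  - exact: slice1.
  - exact: site.
have /choice[q hq] : forall xy : E * E, exists q : R,
    0 <= q /\ flux L.2 xy.1 xy.2 @[L --> W] --> q.
  move=> [x y].
  have W1 : W ((fun L : Lambda R E => flux L.2 x y) @^-1` `[0, C x]%classic).
    apply: filterS WS => L SL; rewrite /= in_itv/= Q0/=.
    apply: le_trans (hC x L SL); rewrite /Z /total_flux (bigD1 y)//= lerDl.
    by apply: sumr_ge0.
  have [l] := ultra_cvg_compact UW (@segment_compact R 0 (C x)) W1.
  by rewrite /= in_itv/= => /andP[l0 _] hl; exists l.
have q0 x y : 0 <= q (x, y) by case: (hq (x, y)).
have [Q QE] := flux_of q0.
have Qcv x y : flux L.2 x y @[L --> W] --> flux Q x y.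
  by rewrite QE; exact: (hq (x, y)).2.
have [mu mucv] := narrow_ultra_cvg (ultra_fmap (fun L : Lambda R E => L.1) UW).
have Qcv' : (fun L : Lambda R E => L.2) @ W --> Q by apply: unif_cts_cvg.
exists ((mu, Q) : Lambda R E); split; last first.
  have /= prcv := cvg_pair mucv Qcv'; move=> A nA.
  have WA : W [set L | A (L.1, L.2)] by exact: (prcv _ _ _ A nA).
  by apply: (@filterS (Lambda R E) W _ _ _ _ WA) => -[].
(* uniform integrability puts the limit into Lambda0 *)
have Zcv x : Z L x @[L --> W] --> total_flux (flux Q) x.
  by apply: cvg_finsum => y; exact: Qcv.
have Zcol x : \sum_(y : E) flux L.2 y x @[L --> W] --> \sum_(y : E) flux Q y x.
  by apply: cvg_finsum => y; exact: Qcv.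
have slcv x f : Cb f -> \int[slice (law L) x]_t f t @[L --> W] -->
    \int[slice (mu : probability _ R) x]_t f t.
  by move=> fC; exact: narrow_slice_cvg.
have lim x := @weighted_rec_cvg R _ W _ (fun L => slice (law L) x)
  (slice (mu : probability _ R) x) (Z^~ x) (total_flux (flux Q) x).
have {}lim x : (\int[slice (mu : probability _ R) x]_t tinv t =
      (total_flux (flux Q) x)%:E)%E /\
    (forall f : ebar_nneg R -> R, Cb f ->
      \int[slice (law L) x]_t (f t * trec t) @[L --> W] -->
      \int[slice (mu : probability _ R) x]_t (f t * trec t)).
  apply: lim => //.
  - by apply: filterS WS => L SL; exact: moment.
  - move=> f; exact: slcv.
  move=> e e0.
  have [n hn] := site_tail (psi0 x) (psiy x) (ltW M_gt0) (normr_ge0 (C x)) e0.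
  exists n; apply: filterS WS => L SL; apply: hn; last exact: site.
    exact: moment.
  by rewrite (le_trans (hC x L SL))// ler_norm.
have LQ : Lambda0 (mu : probability _ R) (flux Q).
  move=> x; split; first exact: (lim x).1.
  apply: (cvg_unique _ (Zcv x)) => //.
  apply: cvg_trans (Zcol x); apply: near_eq_cvg.
  by apply: filterS WS => L [LQ _]; rewrite /Z /total_flux (LQ x).2.
have Q0' x y : 0 <= flux Q x y by exact: flux_nneg.
(* the test inequalities hold before the limit and are continuous along W *)
apply: rate_of_cost => //; apply: cost_from_tests => // g f c n fC ac n0.
pose G (L : Lambda R E) := \sum_(x : E) (jump_test p (flux L.2) x (g x) +
  site_functional psi (slice (law L) x) (Z L x) x (c x) (n x) (f x)).
have Gcv : G L @[L --> W] --> \sum_(x : E) (jump_test p (flux Q) x (g x) +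
  site_functional psi (slice (mu : probability _ R) x) (total_flux (flux Q) x)
    x (c x) (n x) (f x)).
  apply: cvg_finsum => x; apply: cvgD; first exact: jump_test_cvg.
  apply: cvgB; last by apply: cvgM; [exact: Zcv|exact: cvg_cst].
  apply: cvgD; first exact: (lim x).2.
  by apply: cvgM; [exact: cvg_cst|apply: slcv; exact: Cb_escape].
apply: (cvgr_to_le Gcv); apply: filterS WS => L [LLQ cM].
exact: (sublevel_tests p_markov psi0 psiy (Q0 L) LLQ cM).
Qed.
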